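(* Let $\mathscr{M}=\{m_n\}_{n\in\mathbb{N}_0}$ be a weight sequence and $N\ge1$. Let $\{a_\xi\}_{\xi\in\mathbb{Z}^N}$ be a sequence of complex numbers such that for every $\varepsilon>0$ there exists $C_\varepsilon>0$ with $$|a_\xi|\le C_\varepsilon\cdot\sup_{n\in\mathbb{N}_0}\left(\frac{\varepsilon^n(1+|\xi|)^n}{m_n\cdot n!}\right),\qquad\forall\xi\in\mathbb{Z}^N.$$ Then $u=\sum_{\xi\in\mathbb{Z}^N}a_\xi e^{ix\xi}$ belongs to $\mathscr{D}'_{\mathscr{M}}(\mathbb{T}^N)$ and $\widehat{u}(\xi)=a_\xi$ for every $\xi\in\mathbb{Z}^N$.
   Context: $\mathbb{N}=\{1,2,\dots\}$, $\mathbb{N}_0=\mathbb{N}\cup\{0\}$, $\mathbb{T}^N=\mathbb{R}^N/2\pi\mathbb{Z}^N$, and $|\xi|$ is the Euclidean norm of $\xi\in\mathbb{Z}^N$. A weight sequence is a sequence $\mathscr{M}=\{m_n\}_{n\in\mathbb{N}_0}$ of positive reals with: $m_0=m_1=1$; $m_n^2\le m_{n-1}m_{n+1}$ for all $n\in\mathbb{N}$; and there is $H>1$ with $m_{j+k}\le H^{j+k}m_jm_k$ for all $j,k\in\mathbb{N}_0$. $\mathcal{E}_{\mathscr{M}}(\mathbb{T}^N)$ is the space of $f\in C^\infty(\mathbb{T}^N)$ (complex-valued) for which there are $C,h>0$ with $|D^\alpha f(x)|\le C h^{|\alpha|}m_{|\alpha|}|\alpha|!$ for all $x\in\mathbb{T}^N$,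 $\alpha\in\mathbb{N}_0^N$, where $D=-i\partial$. For $h>0$, $\mathcal{E}_{\mathscr{M},h}(\mathbb{T}^N)$ is the Banach space of those $f$ with $\|f\|_{\mathscr{M},h}:=\sup_{x,\alpha}\frac{|D^\alpha f(x)|}{h^{|\alpha|}m_{|\alpha|}|\alpha|!}<\infty$. $\mathcal{E}_{\mathscr{M}}(\mathbb{T}^N)$ carries the locally convex inductive limit topology of the spaces $\mathcal{E}_{\mathscr{M},h_n}(\mathbb{T}^N)$ for any strictly increasing positive sequence $h_n\to+\infty$ (the topology does not depend on the choice). $\mathscr{D}'_{\mathscr{M}}(\mathbb{T}^N)$ is the topological dual of $\mathcal{E}_{\mathscr{M}}(\mathbb{T}^N)$, and $\widehat u(\xi)=\frac{1}{(2\pi)^N}\langle u,e^{-ix\xi}\rangle$ for $\xi\in\mathbb{Z}^N$. A function $f$ is regarded as the functional $\langle f,\varphi\rangle=\int_{\mathbb{T}^N}f\varphi\,dx$. A sequence $u_n\to u$ in $\mathscr{D}'_{\mathscr{M}}(\mathbb{T}^N)$ if $\langle u_n,\varphi\rangle\to\langle u,\varphi\rangle$ for all $\varphi\in\mathcal{E}_{\mathscr{M}}(\mathbb{T}^N)$; the series defining $u$ is the limit in this sense of the partial sums over $|\xi|\le j$ as $j\to\infty$. *)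

(* Defs.v *)
From HB Require Import structures.
From mathcomp Require Import all_boot all_order all_algebra complex.
From mathcomp Require Import all_classical all_reals all_analysis.
From mathcomp Require Import ring lra.
Set Implicit Arguments.
Unset Strict Implicit.
Unset Printing Implicit Defensive.
Import Order.TTheory GRing.Theory Num.Theory.
Import numFieldNormedType.Exports.
Import ComplexField.Normc.
Local Open Scope classical_set_scope.
Local Open Scope complex_scope.
Local Open Scope ring_scope.

Record weightSeq (R : realType) := WeightSeq {
  weight :> nat -> R;
  weight_gt0 : forall n, 0 < weight n;
  weight0 : weight 0%N = 1;
  weight1 : weight 1%N = 1;
  weight_logconvex :
    forall n, weight n.+1 ^+ 2 <= weight n * weight n.+2;
  weight_stable : exists2 H : R, 1 < H &
    forall j k, weight (j + k)%N <= H ^+ (j + k) * weight j * weight k }.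

(* The sequences [h_n] of radii along which the inductive limit is taken. *)
Record radii (R : realType) := Radii {
  radius :> nat -> R;
  radius_gt0 : forall n, 0 < radius n;
  radius_incr : forall n, radius n < radius n.+1;
  radius_cvg : radius @ \oo --> +oo }.

Section smooth.
Variables (R : realType) (N : nat).
Implicit Types (g : 'rV[R]_N -> R) (f : 'rV[R]_N -> R[i]).

Definition partial (i : 'I_N) g : 'rV[R]_N -> R := 'D_(delta_mx 0 i) g.

Definition partials (s : seq 'I_N) g : 'rV[R]_N -> R := foldr partial g s.

(* All iterated partial derivatives exist and are continuous. *)
Definition smooth g := forall s : seq 'I_N,
  continuous (partials s g) /\
  forall i x, derivable (partials s g) x (delta_mx 0 i).

Definition csmooth f := smooth (fun x => complex.Re (f x)) /\ smooth (fun x => complex.Im (f x)).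

(* D_i = - i d/dx_i; the library has no derivatives for functions from a real
   space to R[i], hence the real and imaginary parts. *)
Definition Dpart (i : 'I_N) f : 'rV[R]_N -> R[i] := fun x =>
  (0 -i* 1) * (partial i (fun y => complex.Re (f y)) x +i*
               partial i (fun y => complex.Im (f y)) x).

Definition Dmulti (al : 'I_N -> nat) f : 'rV[R]_N -> R[i] :=
  foldr (fun i => iter (al i) (Dpart i)) f (enum 'I_N).

(* Functions on the torus are 2 pi Z^N-periodic functions on R^N. *)
Definition torus_periodic f := forall x (k : 'rV[int]_N),
  f (x + (2 * pi) *: map_mx intr k) = f x.

(* |alpha| *)
Definition msize (al : 'I_N -> nat) : nat := (\sum_i al i)%N.

End smooth.

Section realsmooth.
Variables (R : realType) (N : nat).
Implicit Types (g : 'rV[R]_N -> R) (f : 'rV[R]_N -> R[i]).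

Lemma partialsL s (a b : R) g1 g2 : smooth g1 -> smooth g2 ->
  partials s (fun x => a * g1 x + b * g2 x) =
  fun x => a * partials s g1 x + b * partials s g2 x.
Proof.
move=> s1 s2; elim: s => [//|i s IH] /=.
rewrite IH /partial; apply/funext => x.
have [_ d1] := s1 s; have [_ d2] := s2 s.
rewrite (_ : (fun y => _) = a *: partials s g1 + b *: partials s g2); last by [].
rewrite deriveD ?deriveZ//; exact: derivableZ.
Qed.

Lemma smoothL (a b : R) g1 g2 : smooth g1 -> smooth g2 ->
  smooth (fun x => a * g1 x + b * g2 x).
Proof.
move=> s1 s2 s; rewrite partialsL//.
have [c1 d1] := s1 s; have [c2 d2] := s2 s.
rewrite (_ : (fun y => _) = a *: partials s g1 + b *: partials s g2); last by [].
split=> [x|i x].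
  exact: (cvgD (cvgM (cvg_cst a) (c1 x)) (cvgM (cvg_cst b) (c2 x))).
by apply: derivableD; exact: derivableZ.
Qed.

Lemma smooth_partial i g : smooth g -> smooth (partial i g).
Proof.
move=> sg s; have := sg (rcons s i).
by rewrite /partials foldr_rcons.
Qed.

Lemma partialL i (a b : R) g1 g2 : smooth g1 -> smooth g2 ->
  partial i (fun x => a * g1 x + b * g2 x) =
  fun x => a * partial i g1 x + b * partial i g2 x.
Proof. by move=> s1 s2; exact: (partialsL [:: i]). Qed.

Lemma eq_smooth g1 g2 : g1 =1 g2 -> smooth g1 -> smooth g2.
Proof. by move=> /funext ->. Qed.

Lemma csmoothL (c : R[i]) f1 f2 : csmooth f1 -> csmooth f2 ->
  csmooth (fun x => c * f1 x + f2 x).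
Proof.
case: c => a b [r1 i1] [r2 i2]; split.
- apply: eq_smooth (smoothL 1 1 (smoothL a (- b) r1 i1) r2) => x.
  by case: (f1 x) (f2 x) => [? ?] [? ?] /=; ring.
- apply: eq_smooth (smoothL 1 1 (smoothL b a r1 i1) i2) => x.
  by case: (f1 x) (f2 x) => [? ?] [? ?] /=; ring.
Qed.

Lemma csmooth_Dpart i f : csmooth f -> csmooth (Dpart i f).
Proof.
move=> [/(@smooth_partial i) sr /(@smooth_partial i) si]; split.
- by apply: eq_smooth (smoothL 0 1 sr si) => x /=; ring.
- by apply: eq_smooth (smoothL (-1) 0 sr si) => x /=; ring.
Qed.

Lemma DpartL i (c : R[i]) f1 f2 : csmooth f1 -> csmooth f2 ->
  Dpart i (fun x => c * f1 x + f2 x) =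
  fun x => c * Dpart i f1 x + Dpart i f2 x.
Proof.
case: c => a b [r1 i1] [r2 i2]; apply/funext => x; rewrite /Dpart.
rewrite [X in partial i X](_ : _ = fun y => 1 *
   (a * complex.Re (f1 y) + - b * complex.Im (f1 y)) + 1 * complex.Re (f2 y)); last first.
  by apply/funext => y; case: (f1 y) (f2 y) => [? ?] [? ?] /=; ring.
rewrite [X in _ +i* partial i X x](_ : _ = fun y => 1 *
   (b * complex.Re (f1 y) + a * complex.Im (f1 y)) + 1 * complex.Im (f2 y)); last first.
  by apply/funext => y; case: (f1 y) (f2 y) => [? ?] [? ?] /=; ring.
have s1 := smoothL a (- b) r1 i1; have s2 := smoothL b a r1 i1.
rewrite (partialL i 1 1 s1 r2) (partialL i 1 1 s2 i2).
rewrite (partialL i a (- b) r1 i1) (partialL i b a r1 i1).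
by apply/eqP; rewrite eq_complex /=; apply/andP; split; apply/eqP; ring.
Qed.

Lemma csmooth_iterD n i f : csmooth f -> csmooth (iter n (Dpart i) f).
Proof. by move=> sf; elim: n => [|n] /=; [exact: sf|exact: csmooth_Dpart]. Qed.

Lemma iterDL n i (c : R[i]) f1 f2 : csmooth f1 -> csmooth f2 ->
  iter n (Dpart i) (fun x => c * f1 x + f2 x) =
  fun x => c * iter n (Dpart i) f1 x + iter n (Dpart i) f2 x.
Proof.
move=> s1 s2; elim: n => [|n IH]; first by [].
rewrite !iterS IH DpartL; [by []|exact: csmooth_iterD|exact: csmooth_iterD].
Qed.

Lemma DmultiL al (c : R[i]) f1 f2 : csmooth f1 -> csmooth f2 ->
  Dmulti al (fun x => c * f1 x + f2 x) =
  fun x => c * Dmulti al f1 x + Dmulti al f2 x.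
Proof.
move=> s1 s2; rewrite /Dmulti; elim: (enum _) => [|i s IH]; first by [].
have sm f : csmooth f ->
    csmooth (foldr (fun i : 'I_N => iter (al i) (Dpart i)) f s).
  by move=> sf; elim: s {IH} => [|j s] /=; [exact: sf|exact: csmooth_iterD].
by rewrite /= IH (iterDL _ _ _ (sm _ s1) (sm _ s2)).
Qed.

End realsmooth.

Section ultradifferentiable.
Variables (R : realType) (N : nat) (M : weightSeq R).
Implicit Types (f : 'rV[R]_N -> R[i]) (al : 'I_N -> nat).

Definition is_ultradiff f := [/\ torus_periodic f, csmooth f &
  exists C h : R, [/\ 0 < C, 0 < h & forall x al,
    normc (Dmulti al f x) <=
      C * h ^+ msize al * M (msize al) * (msize al)`!%:R]].

Definition ultra_norm (h : R) f : \bar R := ereal_sup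
  [set (normc (Dmulti al f x) /
        (h ^+ msize al * M (msize al) * (msize al)`!%:R))%:E
     | x in [set: 'rV[R]_N] & al in [set: 'I_N -> nat]].

Definition ultra_pred : {pred 'rV[R]_N -> R[i]} :=
  fun f => `[< is_ultradiff f >].

Lemma normcE (z : R[i]) : `|z| = (normc z)%:C. Proof. by []. Qed.

Lemma ler_normcD (y z : R[i]) : normc (y + z) <= normc y + normc z.
Proof. by rewrite -lecR rmorphD/= -!normcE ler_normD. Qed.

Lemma normc_ge0 (z : R[i]) : 0 <= normc z.
Proof. by case: z => a b; exact: sqrtr_ge0. Qed.

Lemma normcR (r : R) : normc r%:C = `|r|.
Proof. by rewrite /= expr0n addr0 sqrtr_sqr. Qed.

Lemma is_ultradiffL (c : R[i]) f g : is_ultradiff f -> is_ultradiff g ->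
  is_ultradiff (fun x => c * f x + g x).
Proof.
move=> [pf sf [C1 [h1 [C1p h1p b1]]]] [pg sg [C2 [h2 [C2p h2p b2]]]]; split.
- by move=> x k; rewrite pf pg.
- exact: csmoothL.
exists (normc c * C1 + C2), (h1 + h2).
have cp := normc_ge0 c.
split; [by rewrite ltr_wpDl ?mulr_ge0 ?(ltW C1p)|by rewrite addr_gt0|move=> x al]; rewrite DmultiL//.
apply: le_trans (ler_normcD _ _) _; rewrite normcM.
set n := msize al.
have ler_h (h : R) (h' : R) : 0 < h -> 0 < h' ->
    h ^+ n * M n * n`!%:R <= (h + h') ^+ n * M n * n`!%:R.
  move=> hp h'p; rewrite ler_wpM2r//; rewrite ler_wpM2r//.
    exact/ltW/weight_gt0.
  by rewrite lerXn2r ?nnegrE//; lra.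
apply: (@le_trans _ _ (normc c * (C1 * (h1 ^+ n * M n * n`!%:R)) +
                       C2 * (h2 ^+ n * M n * n`!%:R))).
  apply: lerD; last by rewrite !mulrA b2.
  by rewrite ler_wpM2l// !mulrA b1.
rewrite -3!mulrA !mulrDl !mulrA -!mulrA; apply: lerD.
  rewrite ler_wpM2l// ler_wpM2l ?(ltW C1p)// mulrA.
  by rewrite [leRHS]mulrA ler_h.
rewrite ler_wpM2l ?(ltW C2p)// mulrA [leRHS]mulrA.
by rewrite addrC ler_h.
Qed.

Lemma is_ultradiff0 : is_ultradiff (fun=> 0).
Proof.
have s0 : csmooth (fun _ : 'rV[R]_N => 0 : R[i]).
  have /= z : forall s, partials s (fun _ : 'rV[R]_N => 0 : R) = fun=> 0.
    elim=> //= i s ->; rewrite /partial; apply/funext => x.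
    exact: derive_cst.
  by split=> s; rewrite /= z; (split=> [|i x];
    [exact: cst_continuous|exact: derivable_cst]).
split=> //; exists 1, 1; split=> // x al.
have := DmultiL al (-1) s0 s0.
rewrite (_ : (fun _ => -1 * 0 + 0) = (fun=> 0)); last first.
  by apply/funext => y; rewrite mulr0 addr0.
move=> /(congr1 (fun g => g x)) ->; rewrite mulN1r addNr normc0.
by rewrite expr1n !mul1r mulr_ge0 ?ler0n// ltW// weight_gt0.
Qed.

Lemma ultra_submod : submod_closed ultra_pred.
Proof.
split; first by apply/asboolP; exact: is_ultradiff0.
move=> c f g /asboolP uf /asboolP ug; apply/asboolP.
exact: is_ultradiffL uf ug.
Qed.

HB.instance Definition _ := GRing.isSubmodClosed.Build R[i]
  ('rV[R]_N -> R[i]) ultra_pred ultra_submod.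

End ultradifferentiable.

(* The parameter [h] plays no role in the elements; it only selects the
   sequence of steps used below to define the inductive limit topology. *)
Record ultradiff (R : realType) (N : nat) (M : weightSeq R) (h : radii R) :=
  Ultradiff { ultra_fun :> 'rV[R]_N -> R[i] ;
              ultra_funP : ultra_fun \in ultra_pred M }.

HB.instance Definition _ R N M h := [isSub for @ultra_fun R N M h].
HB.instance Definition _ R N M h := [Choice of @ultradiff R N M h by <:].
HB.instance Definition _ R N M h :=
  [SubChoice_isSubLmodule of @ultradiff R N M h by <:].

Section inductive_topology.
Local Open Scope convex_scope.
Variables (R : realType) (N : nat) (M : weightSeq R) (h : radii R).
Local Notation E := (ultradiff N M h).
Implicit Types (f g : E) (U V : set E) (a b c : R[i]).

Definition abs_convex U := forall f g a b,
  normc a + normc b <= 1 -> U f -> U g -> U (a *: f + b *: g).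

(* The usual base of neighbourhoods of 0 for the locally convex inductive limit
   of the spaces E_{M, h n}, n in nat: the absolutely convex sets whose trace
   on every E_{M, h n} = {ultra_norm M (h n) < +oo} is a neighbourhood of 0 for
   the norm [ultra_norm M (h n)]. *)
Definition ind_base U := abs_convex U /\
  forall n, exists2 r : R, 0 < r &
    forall f, (ultra_norm M (h n) f < r%:E)%E -> U f.

Definition ind_open : set_system E := fun O =>
  forall f, O f -> exists2 U, ind_base U & forall g, U g -> O (f + g).

Lemma ultra_funL c f g : (c *: f + g : E) = (fun x => c * f x + g x) :> (_ -> _).
Proof. by []. Qed.

Lemma ultra_is f : is_ultradiff M f.
Proof. exact/asboolP/(ultra_funP f). Qed.

Lemma ultra_smooth f : csmooth f.
Proof. by have [] := ultra_is f. Qed.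

Lemma Dmulti_ultraZ al c f : Dmulti al (c *: f : E) = fun x => c * Dmulti al f x.
Proof.
have := DmultiL al c (ultra_smooth f) (ultra_smooth (0 : E)).
have -> : (fun x => c * f x + (0 : E) x) = (c *: f : E).
  by apply/funext => x; rewrite -[in RHS](addr0 (c *: f)).
move=> ->; apply/funext => x.
have := DmultiL al (-1) (ultra_smooth (0 : E)) (ultra_smooth (0 : E)).
have -> : (fun x => -1 * (0 : E) x + (0 : E) x) = (0 : E).
  by apply/funext => y; rewrite mulN1r addNr.
move=> /(congr1 (fun g : 'rV[R]_N -> R[i] => g x)) ->.
by rewrite mulN1r addNr addr0.
Qed.

Lemma denom_gt0 (t : R) n : 0 < t -> 0 < t ^+ n * M n * n`!%:R.
Proof.
by move=> t0; rewrite !mulr_gt0 ?exprn_gt0 ?weight_gt0// ltr0n fact_gt0.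
Qed.

Lemma ultra_normP (t r : R) f : 0 < t -> (ultra_norm M t f <= r%:E)%E <->
  forall x al, normc (Dmulti al f x) <=
    r * (t ^+ msize al * M (msize al) * (msize al)`!%:R).
Proof.
move=> t0; split=> [H x al|H].
  rewrite -ler_pdivrMr ?denom_gt0// -lee_fin; apply: le_trans H.
  by apply: ereal_sup_ubound; exists x => //; exists al.
apply: ge_ereal_sup => _ [x _ [al _ <-]].
by rewrite lee_fin ler_pdivrMr ?denom_gt0.
Qed.

Lemma ultra_normZ (t r : R) c f : 0 < t -> (ultra_norm M t f <= r%:E)%E ->
  (ultra_norm M t (c *: f : E) <= (normc c * r)%:E)%E.
Proof.
move=> t0 /ultra_normP H; apply/ultra_normP => // x al.
rewrite Dmulti_ultraZ normcM -[leRHS]mulrA ler_wpM2l ?normc_ge0 ?H//.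
Qed.

Lemma ultra_norm_step f : exists n, exists2 C : R, 0 <= C &
  (ultra_norm M (h n) f <= C%:E)%E.
Proof.
have [_ _ [C [t [C0 t0 b]]]] := ultra_is f.
have [n _ /(_ n (leqnn n)) /= tn] := (cvgryPge (radius h)).1 (radius_cvg h) t.
exists n, C; first exact: ltW.
apply/ultra_normP => [|x al]; first exact: radius_gt0.
apply: le_trans (b x al) _; rewrite -!mulrA ler_wpM2l ?(ltW C0)//.
rewrite ler_wpM2r ?mulr_ge0 ?ler0n//; first exact/ltW/weight_gt0.
by rewrite lerXn2r ?nnegrE// ltW// radius_gt0.
Qed.

Lemma base_bal U a f : ind_base U -> normc a <= 1 -> U f -> U (a *: f).
Proof.
move=> [Uc _] a1 Uf; rewrite -[_ *: _]addr0 -(scale0r f).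
by apply: Uc; rewrite ?normc0 ?addr0.
Qed.

Lemma base_absorb U f : ind_base U ->
  exists2 d : R, 0 < d & forall c, normc c < d -> U (c *: f).
Proof.
move=> [_ UE]; have [n [C C0 fC]] := ultra_norm_step f.
have [r r0 rU] := UE n.
have C1 : 0 < C + 1 by rewrite ltr_wpDl.
exists (r / (C + 1)); first by rewrite divr_gt0.
move=> c; rewrite ltr_pdivlMr// => cr; apply: rU.
apply: le_lt_trans (ultra_normZ c (radius_gt0 h n) fC) _.
rewrite lte_fin; apply: le_lt_trans cr.
by rewrite ler_wpM2l ?normc_ge0// lerDl.
Qed.

Lemma base0 U : ind_base U -> U 0.
Proof.
move=> Ub; have [d d0 /(_ 0)] := base_absorb 0 Ub.
by rewrite normc0 scale0r; exact.
Qed.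

Lemma baseT : ind_base setT.
Proof. by split=> // n; exists 1. Qed.

Lemma baseI U V : ind_base U -> ind_base V -> ind_base (U `&` V).
Proof.
move=> [Uc UE] [Vc VE]; split=> [f g a b ab [Uf Vf] [Ug Vg]|n].
  by split; [exact: Uc|exact: Vc].
have [r r0 rU] := UE n; have [s s0 sV] := VE n.
exists (Num.min r s) => [|f]; first by rewrite lt_min r0.
rewrite EFin_min lt_min => /andP[fr fs].
by split; [exact: rU|exact: sV].
Qed.

Lemma baseZ U c : ind_base U -> ind_base [set f | U (c *: f)].
Proof.
move=> [Uc UE]; split=> [f g a b ab /= Uf Ug|n].
  by rewrite scalerDr !scalerA ![c * _]mulrC -!scalerA; exact: Uc.
have [r r0 rU] := UE n; have c0 := normc_ge0 c.
have c1 : 0 < normc c + 1 by rewrite ltr_wpDl.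
exists (r / (normc c + 1)) => [|f fr]; first by rewrite divr_gt0.
apply: rU; apply: le_lt_trans (ultra_normZ c (radius_gt0 h n) (ltW fr)) _.
by rewrite lte_fin mulrA ltr_pdivrMr// mulrC ltr_pM2l// ltrDl.
Qed.

Lemma base_half U f g : ind_base U -> U (2 *: f) -> U (2 *: g) -> U (f + g).
Proof.
move=> [Uc _] Uf Ug.
have n2 : normc (2^-1 : R[i]) = 2^-1.
  by rewrite normcV -(rmorph_nat (real_complex R)) normcR ger0_norm.
have -> : f + g = 2^-1 *: (2 *: f) + 2^-1 *: (2 *: g).
  by rewrite !scalerA mulVf ?scale1r// pnatr_eq0.
by apply: Uc => //; rewrite n2; lra.
Qed.

Lemma ind_openT : ind_open setT.
Proof. by move=> f _; exists setT => //; exact: baseT. Qed.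

Lemma ind_openI : setI_closed ind_open.
Proof.
move=> O P OO PO f [/OO[U Ub UO] /PO[V Vb VP]].
by exists (U `&` V); [exact: baseI|move=> g [/UO ? /VP ?]].
Qed.

Lemma ind_open_bigU (I : Type) (O : I -> set E) :
  (forall i, ind_open (O i)) -> ind_open (\bigcup_i O i).
Proof.
move=> OO f [i _ /OO[U Ub UO]].
by exists U => // g /UO ?; exists i.
Qed.

HB.instance Definition _ :=
  isOpenTopological.Build E ind_openT ind_openI ind_open_bigU.

Lemma ind_nbhsP f (A : set E) : nbhs f A <->
  exists2 U, ind_base U & forall g, U g -> A (f + g).
Proof.
split=> [|[U Ub UA]].
  rewrite nbhsE; case=> O [Oo Of] OA; have [U Ub UO] := Oo f Of.
  by exists U => // g /UO /OA.
rewrite nbhsE; exists [set k | exists2 V, ind_base V & forall g, V g -> A (k + g)];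
    last first.
  by move=> k [V Vb VA]; rewrite -(addr0 k); apply: VA; exact: base0.
split; last by exists U.
move=> k [V Vb VA]; exists [set g | V (2 *: g)]; first exact: baseZ.
move=> g /= Vg; exists [set g | V (2 *: g)]; first exact: baseZ.
by move=> l /= Vl; rewrite -addrA; apply: VA; exact: base_half.
Qed.

Lemma ultra_add_continuous : continuous (fun x : E * E => x.1 + x.2).
Proof.
move=> [f g] A /ind_nbhsP[U Ub UA].
exists ([set f + k | k in [set k | U (2 *: k)]],
        [set g + k | k in [set k | U (2 *: k)]]) => /=.
  split; apply/ind_nbhsP; exists [set k | U (2 *: k)]; try exact: baseZ.
    by move=> k Uk; exists k.
  by move=> k Uk; exists k.
move=> [_ _] /= [[k Uk <-] [l Ul <-]]; rewrite addrACA.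
by apply: UA; exact: base_half.
Qed.

Lemma ultra_scale_continuous :
  continuous (fun x : R[i]^o * E => x.1 *: x.2).
Proof.
move=> [z f] A /ind_nbhsP[U Ub UA].
have [d d0 Ud] := base_absorb (2 *: f) Ub.
have z0 := normc_ge0 z; set K := normc z + 1.
have K0 : 0 < K by rewrite ltr_wpDl.
exists (ball (z : R[i]^o) ((Num.min d 1)%:C : R[i]),
   [set f + k | k in [set k | U ((2 * K%:C) *: k)]]) => /=.
  split; first by apply: nbhsx_ballx; rewrite ltcR lt_min d0 /=.
  apply/ind_nbhsP; exists [set k | U ((2 * K%:C) *: k)]; first exact: baseZ.
  by move=> k Uk; exists k.
move=> [w _] /= [zw [k Uk <-]]; move: zw.
rewrite /ball /= distrC normcE ltcR lt_min => /andP[wd w1].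
have wK : normc w <= K.
  have := ler_normcD (w - z) z; rewrite subrK => H.
  by apply: le_trans H _; rewrite addrC lerD2l ltW.
have -> : w *: (f + k) = z *: f + (w *: k + (w - z) *: f).
  by rewrite scalerDr scalerBl [RHS]addrCA [RHS]addrC subrKC.
apply: UA; apply: base_half => //; last first.
  by rewrite scalerA mulrC -scalerA; exact: Ud.
have -> : 2 *: (w *: k) = (w / K%:C) *: ((2 * K%:C) *: k).
  rewrite !scalerA; congr (_ *: _); rewrite mulrCA.
  by rewrite -mulrA mulVf ?mulr1// eq_complex /= eqxx andbT gt_eqF.
apply: base_bal => //; rewrite normcM normcV.
rewrite normcR gtr0_norm//.
by rewrite ler_pdivrMr// mul1r.
Qed.

Lemma ultra_locally_convex : exists2 B : set_system E,
  (forall U, U \in B -> convex_set U) & basis B.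
Proof.
exists [set U : set E | open U /\ convex_set (U : set (convex_lmodType E))].
  by move=> U; rewrite inE; case.
split=> [V []//|f A /ind_nbhsP[U Ub UA]].
pose O := [set k : E | exists2 V, ind_base V & forall g, V g -> U (k - f + g)].
have OA : O `<=` A.
  move=> k [V Vb VU]; rewrite -(subrK f k) addrC; apply: UA.
  by rewrite -[_ - _]addr0; apply: VU; exact: base0.
exists O => //; split; last by exists U => // g Ug; rewrite subrr add0r.
split.
  move=> k [V Vb VU]; exists [set g | V (2 *: g)]; first exact: baseZ.
  move=> g /= Vg; exists [set g | V (2 *: g)]; first exact: baseZ.
  move=> l /= Vl; rewrite (addrAC k g) -(addrA (k - f)); apply: VU; exact: base_half.
move=> k1 k2 t; rewrite !inE => -[V1 V1b VU1] [V2 V2b VU2].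
exists (V1 `&` V2); first exact: baseI.
move=> g [/VU1 U1 /VU2 U2].
have t0 : 0 <= t%:num by [].
have t1 : 0 <= 1 - t%:num by rewrite subr_ge0.
have nt : normc (t%:num) + normc (1 - t%:num) <= 1.
  by rewrite -lecR rmorphD /= -!normcE !ger0_norm// addrC subrK.
have -> : (k1 <| t |> k2 : E) - f + g =
    t%:num *: (k1 - f + g) + (1 - t%:num) *: (k2 - f + g).
  have -> : (k1 <| t |> k2 : E) = t%:num *: k1 + (1 - t%:num) *: k2 by [].
  rewrite -3!(addrA _ (- f)); move: (- f + g) => w.
  by rewrite !scalerDr addrACA -scalerDl subrKC scale1r.
exact: (Ub.1).
Qed.

HB.instance Definition _ :=
  PreTopologicalNmodule_isTopologicalNmodule.Build E ultra_add_continuous.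
HB.instance Definition _ :=
  TopologicalNmodule_isTopologicalLmodule.Build R[i] E ultra_scale_continuous.
HB.instance Definition _ := PreTopologicalLmod_isTvs.Build R[i] E
  ultra_add_continuous ultra_scale_continuous ultra_locally_convex.
HB.instance Definition _ := Uniform_isTvs.Build R[i] E ultra_locally_convex.

End inductive_topology.

Record ultradist (R : realType) (N : nat) (M : weightSeq R) (h : radii R) :=
  Ultradist { ultra_form :> {scalar ultradiff N M h} ;
              ultra_formP : continuous (ultra_form : ultradiff N M h -> R[i]^o) }.

Section exponentials.
Variables (R : realType) (N : nat).
Implicit Types (xi k : 'rV[int]_N) (x : 'rV[R]_N).

(* x . xi *)
Definition idot xi x : R := \sum_i x 0 i * (xi 0 i)%:~R.

Definition enorm xi : R := Num.sqrt (\sum_i (xi 0 i)%:~R ^+ 2).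

(* e^(i x . xi) *)
Definition cexp xi : 'rV[R]_N -> R[i] :=
  fun x => cos (idot xi x) +i* sin (idot xi x).

Lemma idot_is_linear xi : linear (idot xi).
Proof.
move=> a x y; rewrite /idot scaler_sumr -big_split; apply: eq_bigr => i _ /=.
by rewrite !mxE mulrDl -mulrA.
Qed.

HB.instance Definition _ xi :=
  GRing.isLinear.Build R 'rV[R]_N R *:%R (idot xi) (idot_is_linear xi).

Lemma idot_delta xi i : idot xi (delta_mx 0 i) = (xi 0 i)%:~R.
Proof.
rewrite /idot (bigD1 i)//= mxE !eqxx mul1r big1 ?addr0// => j ji.
by rewrite mxE (negPf ji) andbF mul0r.
Qed.

Lemma idot_continuous xi : continuous (idot xi).
Proof.
apply: continuous_big => [|i _ x]; first exact: add_continuous.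
exact: (cvgM (@coord_continuous R 1 N 0 i x) (cvg_cst _)).
Qed.

Lemma trig_derive xi i (phi dphi : R -> R) x :
  (forall t : R, is_derive t (1 : R) phi (dphi t)) ->
  is_derive x (delta_mx 0 i) (fun y => phi (idot xi y))
    ((xi 0 i)%:~R * dphi (idot xi x)).
Proof.
move=> dp; set c := idot xi x; set z : R := (xi 0 i)%:~R.
have lE (t : R) : idot xi (t *: delta_mx 0 i + x) = z * t + c.
  by rewrite linearD linearZ /= idot_delta mulrC.
pose g (t : R) := phi (z * t + c).
have [dg eg] : is_derive (0 : R) (1 : R) g (z * dphi c).
  have dl : is_derive (0 : R) (1 : R) (fun t : R => z * t + c) z.
    by apply: is_derive_eq; rewrite /= addr0 [_%:A]mulr1.
  have := @is_derive1_comp R phi (fun t => z * t + c) 0 _ _ (dp (z * 0 + c)) dl.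
  by rewrite mulr0 add0r mulrC.
split.
  apply/derivable1P; rewrite (_ : (fun t : R => _) = g)//.
  by rewrite funeqE => t; rewrite lE.
rewrite -eg /derive.
rewrite (_ : (fun t : R => _) = fun t => t^-1 *: ((g \o shift 0) (t *: 1) - g 0))//.
by rewrite funeqE => t /=; rewrite lE /g addr0 [_%:A]mulr1 mulr0 add0r.
Qed.

Lemma continuous_phi xi (phi : R -> R) (a : R) : continuous phi ->
  continuous (fun x => a * phi (idot xi x)).
Proof.
move=> cp x.
have H : phi (idot xi y) @[y --> x] --> phi (idot xi x).
  exact: (continuous_comp (@idot_continuous xi x) (cp (idot xi x))).
exact: (cvgM (cvg_cst a) H).
Qed.

Definition trig xi (a b : R) : 'rV[R]_N -> R :=
  fun x => a * cos (idot xi x) + b * sin (idot xi x).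

Lemma is_derive_trig xi a b i x : is_derive x (delta_mx 0 i) (trig xi a b)
  (trig xi ((xi 0 i)%:~R * b) (- ((xi 0 i)%:~R * a)) x).
Proof.
have dc := trig_derive xi i x (@is_derive_cos R).
have ds := trig_derive xi i x (@is_derive_sin R).
rewrite (_ : trig xi a b = a *: (fun y => cos (idot xi y)) +
  b *: (fun y => sin (idot xi y))); last by [].
apply: (@is_derive_eq _ _ _ _ _ _ _ _ (is_deriveD (is_deriveZ a dc) (is_deriveZ b ds))).
rewrite /trig /GRing.scale /=; ring.
Qed.

Lemma partial_trig xi a b i : partial i (trig xi a b) =
  trig xi ((xi 0 i)%:~R * b) (- ((xi 0 i)%:~R * a)).
Proof. by apply/funext => x; rewrite /partial; have [_ ->] := is_derive_trig xi a b i x. Qed.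

Lemma trig_smooth xi a b : smooth (trig xi a b).
Proof.
move=> s; have [{}a [{}b ->]] : exists a' b', partials s (trig xi a b) = trig xi a' b'.
  elim: s => [|i s [a' [b' /= ->]]]; first by exists a, b.
  by rewrite partial_trig; do 2 eexists.
split=> [x|i x]; last by have [] := is_derive_trig xi a b i x.
exact: (cvgD (@continuous_phi xi _ a (@continuous_cos R) x) (@continuous_phi xi _ b (@continuous_sin R) x)).
Qed.

Lemma cexp_csmooth xi : csmooth (cexp xi).
Proof.
split.
- by apply: eq_smooth (trig_smooth xi 1 0) => x; rewrite /trig /=; ring.
- by apply: eq_smooth (trig_smooth xi 0 1) => x; rewrite /trig /=; ring.
Qed.

Lemma Dpart_cexp i xi (c : R) : Dpart i (fun x => c%:C * cexp xi x) =
  fun x => (c * (xi 0 i)%:~R)%:C * cexp xi x.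
Proof.
apply/funext => x; rewrite /Dpart.
rewrite [X in partial i X](_ : _ = trig xi c 0); last first.
  by apply/funext => y; rewrite /trig /=; ring.
rewrite [X in _ +i* partial i X x](_ : _ = trig xi 0 c); last first.
  by apply/funext => y; rewrite /trig /=; ring.
rewrite !partial_trig /trig.
by apply/eqP; rewrite eq_complex /=; apply/andP; split; apply/eqP; ring.
Qed.

Lemma normc_cexp xi x : normc (cexp xi x) = 1.
Proof. by rewrite /= cos2Dsin2 sqrtr1. Qed.

Lemma Dmulti_cexp al xi : exists2 c : R,
  Dmulti al (cexp xi) = (fun x => c%:C * cexp xi x) &
  `|c| <= (1 + \sum_i `|(xi 0 i)%:~R : R|) ^+ msize al.
Proof.
set L := 1 + _; have L1 : 1 <= L by rewrite lerDl sumr_ge0.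
have zL i : `|(xi 0 i)%:~R : R| <= L.
  by rewrite /L (bigD1 i)//= addrCA lerDl addr_ge0// sumr_ge0.
suff [c -> cL] : exists2 c : R, Dmulti al (cexp xi) = (fun x => c%:C * cexp xi x) &
    `|c| <= L ^+ (\sum_(i <- enum 'I_N) al i)%N.
  by exists c => //; rewrite /msize -big_enum.
rewrite /Dmulti; elim: (enum 'I_N) => [|i s [c /= -> cL]].
  exists 1; last by rewrite big_nil normr1.
  by apply/funext => x /=; rewrite mul1r.
rewrite big_cons; elim: (al i) => [|n [d /= -> dL]]; first by exists c.
exists (d * (xi 0 i)%:~R); first by rewrite Dpart_cexp.
by rewrite normrM addSn exprSr ler_pM.
Qed.

Lemma periodicz (phi : R -> R) T (n : int) : periodic phi T ->
  forall t, phi (t + T *~ n) = phi t.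
Proof.
move=> p t; case: n => n; first exact: (periodicn p).
by rewrite NegzE mulrNz -[in RHS](subrK (T *+ n.+1) t) (periodicn p).
Qed.

Lemma cexp_periodic xi : torus_periodic (cexp xi).
Proof.
move=> x k.
have E : idot xi (x + (2 * pi) *: map_mx intr k) =
    idot xi x + (pi *+ 2) *~ (\sum_i k 0 i * xi 0 i).
  rewrite linearD linearZ /=; congr (_ + _).
  rewrite -[RHS]mulrzr -(mulr_natl pi); congr (_ * _).
  rewrite /idot (big_morph intr (@intrD R) (mulr0z 1)); apply: eq_bigr => i _.
  by rewrite mxE intrM.
by rewrite /cexp E !periodicz//; [exact: sinD2pi|exact: cosD2pi].
Qed.

Variable M : weightSeq R.

Lemma weight_ge1 n : 1 <= M n.
Proof.
have mono j : M j <= M j.+1.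
  elim: j => [|j IH]; first by rewrite weight0 weight1.
  have := weight_logconvex M j; rewrite expr2 => H.
  rewrite -(ler_pM2l (weight_gt0 M j.+1)); apply: le_trans H _.
  by rewrite ler_wpM2r// ltW// weight_gt0.
by elim: n => [|n IH]; [rewrite weight0|exact: le_trans IH (mono n)].
Qed.

Lemma cexp_ultra xi : cexp xi \in ultra_pred M.
Proof.
apply/asboolP; split; [exact: cexp_periodic|exact: cexp_csmooth|].
set L := 1 + \sum_i `|(xi 0 i)%:~R : R|.
have L0 : 0 < L by rewrite ltr_wpDr// sumr_ge0.
exists 1, L; split => // x al; have [c -> cL] := Dmulti_cexp al xi.
rewrite normcM normc_cexp normcR mulr1 mul1r -mulrA.
apply: le_trans cL _; rewrite ler_peMr ?exprn_ge0 ?(ltW L0)//.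
by rewrite -[leLHS]mulr1 ler_pM ?weight_ge1// ler1n fact_gt0.
Qed.

End exponentials.

Section ultradistributions.
Variable R : realType.

(* Iterated Lebesgue integral over [0, 2 pi]^n, the library having no n-fold
   product measure; the integrands below are continuous. *)
Fixpoint cube_integral (n : nat) : ('rV[R]_n -> R) -> R :=
  match n return ('rV[R]_n -> R) -> R with
  | 0%N => fun g => g 0
  | n'.+1 => fun g => \int[lebesgue_measure]_(t in `[0, 2 * pi])
      @cube_integral n' (fun y => g (row_mx (const_mx t : 'rV[R]_1) y))
  end.

Definition torus_integral (n : nat) (f : 'rV[R]_n -> R[i]) : R[i] :=
  cube_integral (fun x => complex.Re (f x)) +i*
  cube_integral (fun x => complex.Im (f x)).

Variables (N : nat) (M : weightSeq R) (h : radii R).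
Implicit Types (f : 'rV[R]_N -> R[i]) (phi : ultradiff N M h).
Implicit Types (u v : ultradist N M h) (a : 'rV[int]_N -> R[i]).

Definition cexpU (xi : 'rV[int]_N) : ultradiff N M h :=
  Ultradiff h (cexp_ultra M xi).

Definition fourier_coef u (xi : 'rV[int]_N) : R[i] :=
  (((2 * pi) ^+ N)^-1)%:C * u (cexpU (- xi)).

Definition represents f u := forall phi,
  u phi = torus_integral (fun x => f x * phi x).

(* A finite sum: [\sum_(_ \in _)] sums over the finitely many indices of the
   ball at which the term is nonzero. *)
Definition trig_psum a (j : nat) : 'rV[R]_N -> R[i] := fun x =>
  \sum_(xi \in [set xi : 'rV[int]_N | enorm R xi <= j%:R]) a xi * cexp xi x.

Definition ultradist_cvg (v : nat -> ultradist N M h) u := forall phi,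
  (fun n => v n phi : R[i]^o) @ \oo --> (u phi : R[i]^o).

Definition is_trig_series a u :=
  exists2 s : nat -> ultradist N M h,
    forall j, represents (trig_psum a j) (s j) & ultradist_cvg s u.

End ultradistributions.

(* Main.v *)
From HB Require Import structures.
Require Import Defs.
From mathcomp Require Import all_boot all_order all_algebra complex.
From mathcomp Require Import all_classical all_reals all_analysis.
From mathcomp Require Import finmap zify ring lra.
Set Implicit Arguments.
Unset Strict Implicit.
Unset Printing Implicit Defensive.
Import Order.TTheory GRing.Theory Num.Theory.
Import numFieldNormedType.Exports.
Import ComplexField.Normc.
Local Open Scope classical_set_scope.
Local Open Scope complex_scope.
Local Open Scope ring_scope.

(** Each character [cexp xi] defines a form [pairing xi] on the test functions,
    f |-> the integral of f e^(i x . xi), and the partial sums of the series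
    are the forms sum_(|xi| <= j) a_xi (pairing xi). Everything follows from a
    summable bound of their terms, uniform on the unit ball of every step
    E_(M,t) of the inductive limit.

    The decay of [pairing xi f] comes from the identity
    pairing xi (D_i f) = - xi_i pairing xi f ([pairing_Dpart]). Instead of
    integrating by parts in an iterated integral, which would need a derivative
    under the integral sign, the proof uses that the integral over the torus is
    invariant under translations ([cube_integral_shift]): translating f by
    s e_i multiplies [pairing xi f] by e^(- i s xi_i), and the identity is
    the first order part in s of this relation. The Taylor remainders are
    O(s^2) because the second derivatives of f are bounded. Iterating, for
    |D^al f| <= r t^|al| m_|al| |al|! one obtains
      (1 + |xi|)^n |pairing xi f| <= A r K^n m_n n!
    for all n ([pairing_decay]), where A depends on N only and K on N and t.

    This is used with n + d for n, where d = N + 2. Stability of the weight,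
    m_(n+d) <= H^(n+d) m_n m_d, and (n+d)! <= 2^(n+d) n! d! turn it into
      (eps^n (1 + |xi|)^n / (m_n n!)) (1 + |xi|)^d |pairing xi f| <= Q r
    when eps = 1 / (2 K H). The supremum over n is the growth allowed for a_xi,
    so that |a_xi pairing xi f| <= Q' r (1 + |xi|)^(-N-2) ([term_bound]).
    There are O(j^N) lattice points in the ball of radius j, hence the partial
    sums converge at rate O(1/j) ([ball_sum_cauchy]), and the limit is bounded on
    every step, which means that it is continuous ([ultradist_limit]).

    The Fourier coefficients of u are then read off from the partial sums, by
    orthogonality of the characters. Orthogonality is again [pairing_Dpart]:
    the character of frequency - eta is an eigenfunction of D_i for the
    eigenvalue - eta_i, whence (xi_i - eta_i) pairing xi (cexp (- eta)) = 0. *)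

(** * Integrals over an interval *)

Section circle.
Context {R : realType}.
Implicit Types g : R -> R.

Lemma continuous_integrable_itv g (a b : R) : continuous g ->
  lebesgue_measure.-integrable `[a, b] (EFin \o g).
Proof.
move=> gc; apply: continuous_compact_integrable; first exact: segment_compact.
exact: continuous_subspaceT.
Qed.

Lemma Rintegral_itv_cst (a b c : R) : a <= b ->
  \int[lebesgue_measure]_(_ in `[a, b]) c = c * (b - a).
Proof.
move=> ab; rewrite Rintegral_cst//= lebesgue_measure_itv/= lte_fin.
by move: ab; rewrite le_eqVlt => /predU1P[->|->]; rewrite ?ltxx ?subrr.
Qed.

Lemma Rintegral_itv_bound g (a b B : R) : a <= b -> continuous g ->
  (forall t, t \in `[a, b] -> `|g t| <= B) ->
  `|\int[lebesgue_measure]_(t in `[a, b]) g t| <= B * (b - a).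
Proof.
move=> ab gc gB.
apply: (@le_trans _ _ (\int[lebesgue_measure]_(t in `[a, b]) `|g t|)).
  by apply: le_normr_Rintegral => //; exact: continuous_integrable_itv.
rewrite -(Rintegral_itv_cst B ab); apply: le_Rintegral => //.
- apply: continuous_integrable_itv => t.
  by apply: (continuous_comp (gc t)); exact: norm_continuous.
- by apply: continuous_integrable_itv => t; exact: cvg_cst.
Qed.

(** Since [a, b] is compact, continuity of K at the points (p, t) is uniform
    in t. *)
Lemma continuous_Rintegral (P : topologicalType) (K : P -> R -> R) (a b : R) :
  a <= b -> continuous (fun z : P * R => K z.1 z.2) ->
  continuous (fun p => \int[lebesgue_measure]_(t in `[a, b]) K p t).
Proof.
move=> ab Kc p.
have Kp q : continuous (K q).
  move=> t; apply: (@continuous_comp _ _ _ (fun t => (q, t))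
    (fun z : P * R => K z.1 z.2) t).
    by apply: (cvg_pair (cvg_cst q) cvg_id).
  exact: Kc.
apply/cvgrPdist_le => e e0.
pose d := e / (b - a + 1).
have ab1 : 0 < b - a + 1 by lra.
have d0 : 0 < d by rewrite divr_gt0.
have near_p : \forall q \near p, `[a, b] `<=` [set t | `|K p t - K q t| <= d].
  have /compact_near_coveringP H := @segment_compact R a b.
  apply: (H _ _ (fun q t => `|K p t - K q t| <= d)) => t _.
  have d20 : 0 < d / 2 by rewrite divr_gt0.
  have /cvgrPdist_le/(_ _ d20) Kpt := Kc (p, t).
  have /cvgrPdist_le/(_ _ d20) Kt := Kp p t.
  have [[A B] /= [Ap Bt] AB] := Kpt.
  exists (B `&` [set t' | `|K p t - K p t'| <= d / 2], A) => /=.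
    by split=> //; apply: filterI.
  move=> [t' q] /= [[Bt' tt'] Aq].
  have /= qt := AB (q, t') (conj Aq Bt').
  have -> : K p t' - K q t' = (K p t - K q t') - (K p t - K p t') by ring.
  apply: le_trans (ler_normB _ _) _; lra.
near=> q.
rewrite -RintegralB//; [|exact: continuous_integrable_itv..].
apply: (@le_trans _ _ (d * (b - a))).
  apply: Rintegral_itv_bound => //.
    by move=> t; apply: cvgB; exact: Kp.
  by move=> t tab; apply: (near near_p q) => //.
rewrite /d -mulrA ler_piMr ?(ltW e0)// mulrC ler_pdivrMr//; lra.
Unshelve. all: by end_near. Qed.

Lemma is_derive_shift (F : R -> R) (s x dF : R) :
  is_derive (x + s) 1 F dF -> is_derive x 1 (fun t => F (t + s)) dF.
Proof.
move=> dFs.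
have ds : is_derive x 1 (fun t : R => t + s) 1.
  by apply: is_derive_eq; rewrite addr0.
by have := @is_derive1_comp R F (fun t => t + s) x _ _ dFs ds; rewrite mulr1.
Qed.

(** Let F be a primitive of g. Both sides are increments F (y + T) - F y, and
    such an increment does not depend on y because its derivative is
    g (y + T) - g y = 0. *)
Lemma Rintegral_shift_periodic g (T s : R) : 0 < T -> continuous g ->
  (forall t, g (t + T) = g t) ->
  \int[lebesgue_measure]_(t in `[0, T]) g (t + s) =
  \int[lebesgue_measure]_(t in `[0, T]) g t.
Proof.
move=> T0 gc gT; pose L : R := - (`|s| + 1).
have L0 : L < 0 by rewrite /L oppr_lt0 ltr_wpDl.
(* F is based at L, to the left of both 0 and s, so as to be a primitive
   around each point that is used. *)
have Ls : L < s.
  by rewrite /L ltrNl; apply: le_lt_trans (ler_norm (- s)) _; rewrite normrN ltrDl.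
pose F (x : R) : R := \int[lebesgue_measure]_(t in `[L, x]) g t.
have dF (x : R) : L < x -> is_derive x 1 F (g x).
  move=> Lx.
  have [] := @continuous_FTC1_closed R g L x (x + 1) _ _ Lx (gc x).
  - by rewrite ltrDl.
  - exact: continuous_integrable_itv.
  by rewrite derive1E => Fd Fg; split.
have int_F (r : R) : L < r ->
    \int[lebesgue_measure]_(t in `[0, T]) g (t + r) = F (T + r) - F r.
  move=> Lr.
  have dFr (x : R) : 0 <= x -> is_derive x 1 (fun t => F (t + r)) (g (x + r)).
    move=> x0; apply: is_derive_shift; apply: dF; lra.
  rewrite /Rintegral (@continuous_FTC2 R (fun t => g (t + r)) (fun t => F (t + r)))//=.
  - by rewrite add0r.
  - apply: continuous_subspaceT => x.
    apply: (@continuous_comp _ _ _ (fun t => t + r) g); last exact: gc.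
    by apply: cvgD => //; exact: cvg_cst.
  - have cF (x : R) : 0 <= x -> {for x, continuous (fun t => F (t + r))}.
      move=> /dFr [dx _]; apply/differentiable_continuous.
      exact/derivable1_diffP.
    split.
    + by move=> x /[!in_itv]/= /andP[x0 _]; have [] := dFr x (ltW x0).
    + by apply: cvg_at_right_filter; exact: cF.
    + by apply: cvg_at_left_filter; exact: cF (ltW T0).
  - move=> x /[!in_itv]/= /andP[x0 _]; rewrite derive1E.
    by have [_ ->] := dFr x (ltW x0).
have dPhi (x : R) : L < x -> is_derive x 1 (fun t => F (t + T) - F t) 0.
  move=> Lx.
  have d1 : is_derive x 1 (fun t => F (t + T)) (g (x + T)).
    by apply: is_derive_shift; apply: dF; lra.
  have := is_deriveB d1 (dF x Lx).
  by rewrite gT subrr.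
have cst (x y : R) : L < x -> x <= y -> F (y + T) - F y = F (x + T) - F x.
  move=> Lx xy; apply/eqP; rewrite -subr_eq0; apply/eqP.
  have [||c _ ->] := @MVT_segment R (fun t => F (t + T) - F t) (fun=> 0) x y xy.
  - by move=> z /[!in_itv]/= /andP[xz _]; apply: dPhi; lra.
  - apply: derivable_within_continuous => z /[!in_itv]/= /andP[xz _].
    by have [] := dPhi z (lt_le_trans Lx xz).
  by rewrite mul0r.
rewrite int_F//.
under [RHS]eq_Rintegral do rewrite -[X in g X]addr0.
rewrite int_F// ![T + _]addrC.
by have [s0|s0] := leP 0 s; [apply: cst|apply/esym/cst => //; exact: ltW].
Qed.

End circle.

(** * Iterated integrals over the cube *)

Section cube.
Context {R : realType}.

Lemma continuous_pair (P Q S : topologicalType) (f : P -> Q) (g : P -> S) :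
  continuous f -> continuous g -> continuous (fun p => (f p, g p)).
Proof. by move=> fc gc p; exact: (cvg_pair (fc p) (gc p)). Qed.

Lemma continuous_rV (P : topologicalType) n (f : P -> 'rV[R]_n) :
  (forall j, continuous (fun p => f p 0 j)) -> continuous f.
Proof.
move=> fc p A [B nB BA].
have : \forall q \near p, forall j, B 0 j (f q 0 j).
  by apply: filter_forall => j; apply: fc; exact: nB.
by apply: filterS => q Bq; apply: BA => i j; rewrite ord1.
Qed.

Lemma continuous_row_cons (P : topologicalType) n (f : P -> R) (g : P -> 'rV[R]_n) :
  continuous f -> continuous g ->
  continuous (fun p => row_mx (const_mx (f p) : 'rV[R]_1) (g p)).
Proof.
move=> fc gc; apply: continuous_rV => j.
rewrite (_ : (fun p => _) = fun p =>
  match fintype.split j with inl _ => f p | inr k => g p 0 k end); last first.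
  by apply/funext => p; rewrite mxE; case: fintype.splitP => k _; rewrite ?mxE.
case: (fintype.split j) => k; first exact: fc.
move=> p; apply: (@continuous_comp _ _ _ g (fun M : 'rV[R]_n => M 0 k)).
  exact: gc.
exact: coord_continuous.
Qed.

Lemma continuous_slice (P : topologicalType) n (G : P -> 'rV[R]_n.+1 -> R) :
  continuous (fun z => G z.1 z.2) ->
  continuous (fun z : (P * R) * 'rV[R]_n =>
    G z.1.1 (row_mx (const_mx z.1.2 : 'rV[R]_1) z.2)).
Proof.
move=> Gc z; pose e (z : (P * R) * 'rV[R]_n) : P * 'rV[R]_n.+1 :=
  (z.1.1, row_mx (const_mx z.1.2 : 'rV[R]_1) z.2).
apply: (@continuous_comp _ _ _ e (fun z => G z.1 z.2)); last exact: Gc.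
move: z; apply: (continuous_pair (f := fun z : P * R * 'rV[R]_n => z.1.1)
  (g := fun z : P * R * 'rV[R]_n => row_mx (const_mx z.1.2 : 'rV[R]_1) z.2)) => [z|].
  by apply: (@continuous_comp _ _ _ fst fst); exact: cvg_fst.
apply: (@continuous_row_cons _ n (fun z : P * R * 'rV[R]_n => z.1.2) snd) => z.
- by apply: (@continuous_comp _ _ _ fst snd); [exact: cvg_fst|exact: cvg_snd].
- exact: cvg_snd.
Qed.

(** Allowing an arbitrary parameter space P makes the induction on the
    dimension work: the outermost variable of the cube joins the parameters. *)
Lemma continuous_cube (P : topologicalType) n (G : P -> 'rV[R]_n -> R) :
  continuous (fun z => G z.1 z.2) -> continuous (fun p => cube_integral (G p)).
Proof.
elim: n P G => [|n IH] P G Gc.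
  move=> p; apply: (@continuous_comp _ _ _ (fun p => (p, 0 : 'rV[R]_0))
    (fun z : P * 'rV[R]_0 => G z.1 z.2)); last exact: Gc.
  exact: (cvg_pair cvg_id (cvg_cst _)).
apply: (@continuous_Rintegral _ _ (fun p t =>
  cube_integral (fun y => G p (row_mx (const_mx t : 'rV[R]_1) y)))).
  by rewrite mulr_ge0// pi_ge0.
exact: (IH _ (fun (z : P * R) y => G z.1 (row_mx (const_mx z.2 : 'rV[R]_1) y)))
  (continuous_slice Gc).
Qed.

Lemma slice_continuous n (g : 'rV[R]_n.+1 -> R) t : continuous g ->
  continuous (fun y : 'rV[R]_n => g (row_mx (const_mx t : 'rV[R]_1) y)).
Proof.
move=> gc y; apply: (@continuous_comp _ _ _
  (fun y : 'rV[R]_n => row_mx (const_mx t : 'rV[R]_1) y) g); last exact: gc.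
by apply: (@continuous_row_cons _ n (fun=> t) id) => ?;
  [exact: cst_continuous|exact: cvg_id].
Qed.

Lemma cube_slice_continuous n (g : 'rV[R]_n.+1 -> R) : continuous g ->
  continuous (fun t : R =>
    cube_integral (fun y : 'rV[R]_n => g (row_mx (const_mx t : 'rV[R]_1) y))).
Proof.
move=> gc.
apply: (@continuous_cube _ n
  (fun (t : R) y => g (row_mx (const_mx t : 'rV[R]_1) y))) => z.
apply: (@continuous_comp _ _ _
  (fun z : R * 'rV[R]_n => row_mx (const_mx z.1 : 'rV[R]_1) z.2) g); last exact: gc.
by apply: (@continuous_row_cons _ n fst snd) => ?; [exact: cvg_fst|exact: cvg_snd].
Qed.

Lemma cube_integralL n (a b : R) (g1 g2 : 'rV[R]_n -> R) :
  continuous g1 -> continuous g2 ->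
  cube_integral (fun x => a * g1 x + b * g2 x) =
  a * cube_integral g1 + b * cube_integral g2.
Proof.
elim: n g1 g2 => [//|n IH] g1 g2 c1 c2 /=.
under eq_Rintegral do rewrite (IH _ _ (slice_continuous c1) (slice_continuous c2)).
have i1 := continuous_integrable_itv 0 (2 * pi) (cube_slice_continuous c1).
have i2 := continuous_integrable_itv 0 (2 * pi) (cube_slice_continuous c2).
have iZ c (g : R -> R) : lebesgue_measure.-integrable `[0, 2 * pi] (EFin \o g) ->
    lebesgue_measure.-integrable `[0, 2 * pi] (EFin \o (fun t => c * g t)).
  by move=> ig; apply: (integrableZl _ c ig).
by rewrite RintegralD ?RintegralZl//; exact: iZ.
Qed.

Lemma cube_integral_cst n (c : R) :
  cube_integral (fun _ : 'rV[R]_n => c) = c * (2 * pi) ^+ n.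
Proof.
elim: n => [|n IH] /=; first by rewrite mulr1.
under eq_Rintegral do rewrite IH.
by rewrite Rintegral_itv_cst ?mulr_ge0 ?pi_ge0// subr0 exprSr -mulrA.
Qed.

Lemma cube_integral_bound n (g : 'rV[R]_n -> R) (B : R) : continuous g ->
  (forall x, `|g x| <= B) -> `|cube_integral g| <= B * (2 * pi) ^+ n.
Proof.
elim: n g => [|n IH] g gc gB /=; first by rewrite mulr1.
rewrite exprSr mulrA -[X in _ <= _ * X]subr0; apply: Rintegral_itv_bound.
- by rewrite mulr_ge0 ?pi_ge0.
- exact: cube_slice_continuous.
- by move=> t _; apply: IH => //; exact: slice_continuous.
Qed.

Definition periodic_rV n (g : 'rV[R]_n -> R) := forall x (k : 'rV[int]_n),
  g (x + (2 * pi) *: map_mx intr k) = g x.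

(** One coordinate at a time: the inner integral is invariant by induction,
    and, as a function of the outer variable, it is again continuous and
    periodic. *)
Lemma cube_integral_shift n (g : 'rV[R]_n -> R) (v : 'rV[R]_n) :
  continuous g -> periodic_rV g ->
  cube_integral (fun x => g (x + v)) = cube_integral g.
Proof.
elim: n g v => [|n IH] g v gc gp /=; first by rewrite [v]thinmx0 addr0.
have gp_row (x1 : 'rV[R]_1) (y : 'rV[R]_n) (k1 : 'rV[int]_1) (k : 'rV[int]_n) :
    g (row_mx (x1 + (2 * pi) *: map_mx intr k1) (y + (2 * pi) *: map_mx intr k)) =
    g (row_mx x1 y).
  rewrite -[RHS](gp _ (row_mx k1 k)); congr g.
  have : row_mx x1 y + (2 * pi) *: map_mx intr (row_mx k1 k) =
      row_mx (x1 + (2 * pi) *: map_mx intr k1) (y + (2 * pi) *: map_mx intr k).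
    by rewrite map_row_mx scale_row_mx add_row_mx.
  by move=> /esym.
have gslice t : periodic_rV (fun y : 'rV[R]_n => g (row_mx (const_mx t : 'rV[R]_1) y)).
  move=> y k; rewrite -[RHS](gp_row _ _ 0 k).
  by rewrite map_mx0 scaler0 addr0.
pose v0 := lsubmx (v : 'rV[R]_(1 + n)) 0 0.
have gE t (y : 'rV[R]_n) : g (row_mx (const_mx t : 'rV[R]_1) y + v) =
    g (row_mx (const_mx (t + v0) : 'rV[R]_1) (y + rsubmx (v : 'rV[R]_(1 + n)))).
  suff E : row_mx (const_mx t : 'rV[R]_1) y + (v : 'rV[R]_(1 + n)) =
      row_mx (const_mx (t + v0)) (y + rsubmx (v : 'rV[R]_(1 + n))).
    by exact: (congr1 (g : 'rV[R]_(1 + n) -> R) E).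
  rewrite [X in _ + X = _](_ : _ = row_mx (lsubmx (v : 'rV[R]_(1 + n)))
    (rsubmx (v : 'rV[R]_(1 + n)))); last by rewrite hsubmxK.
  rewrite add_row_mx; congr (row_mx _ _).
  by apply/rowP => j; rewrite ord1 /v0 !mxE.
under eq_Rintegral => t _.
  under eq_fun do rewrite gE.
  rewrite (IH (fun y => g (row_mx (const_mx (t + v0) : 'rV[R]_1) y)) _
    (slice_continuous gc) (gslice _)).
  over.
apply: (Rintegral_shift_periodic (g := fun t => cube_integral
  (fun y => g (row_mx (const_mx t : 'rV[R]_1) y)))).
- by rewrite mulr_gt0// pi_gt0.
- exact: cube_slice_continuous.
move=> t; congr cube_integral; apply/funext => y.
rewrite -[RHS](gp_row _ _ (const_mx 1) 0) map_mx0 scaler0 addr0.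
rewrite [X in row_mx X _](_ : _ = const_mx t + (2 * pi) *: map_mx intr (const_mx 1))//.
by apply/rowP => j; rewrite !mxE mulr1.
Qed.

End cube.

(** * Complex functions on the torus *)

Section torus.
Context {R : realType} {n : nat}.
Implicit Types (f : 'rV[R]_n -> R[i]) (z w : R[i]).

Lemma ler_Re_normc z : `|complex.Re z| <= normc z.
Proof.
case: z => a b /=; rewrite -sqrtr_sqr ler_wsqrtr// lerDl sqr_ge0//.
Qed.

Lemma ler_Im_normc z : `|complex.Im z| <= normc z.
Proof.
case: z => a b /=; rewrite -sqrtr_sqr ler_wsqrtr// lerDr sqr_ge0//.
Qed.

Lemma ler_normc_ReIm z : normc z <= `|complex.Re z| + `|complex.Im z|.
Proof.
have /= := ler_normcD (complex.Re z)%:C (0 +i* complex.Im z).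
case: z => a b /=; rewrite !expr0n/= !addr0 !add0r !sqrtr_sqr.
by move=> H; apply: le_trans H.
Qed.

Definition ccontinuous f :=
  continuous (fun x => complex.Re (f x)) /\ continuous (fun x => complex.Im (f x)).

Lemma csmooth_continuous f : csmooth f -> ccontinuous f.
Proof. by move=> [sr si]; split; [have [] := sr [::]|have [] := si [::]]. Qed.

Lemma ccontinuous_cst z : ccontinuous (fun=> z).
Proof. by split; exact: cst_continuous. Qed.

Lemma ccontinuousD f1 f2 : ccontinuous f1 -> ccontinuous f2 ->
  ccontinuous (fun x => f1 x + f2 x).
Proof.
move=> [r1 i1] [r2 i2]; split=> x.
- rewrite (_ : (fun y => _) = fun y => complex.Re (f1 y) + complex.Re (f2 y)); last first.
    by apply/funext => y; rewrite raddfD.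
  exact: (cvgD (r1 x) (r2 x)).
- rewrite (_ : (fun y => _) = fun y => complex.Im (f1 y) + complex.Im (f2 y)); last first.
    by apply/funext => y; rewrite raddfD.
  exact: (cvgD (i1 x) (i2 x)).
Qed.

Lemma ccontinuousM f1 f2 : ccontinuous f1 -> ccontinuous f2 ->
  ccontinuous (fun x => f1 x * f2 x).
Proof.
move=> [r1 i1] [r2 i2]; split=> x.
- rewrite (_ : (fun y => _) = fun y => complex.Re (f1 y) * complex.Re (f2 y) -
    complex.Im (f1 y) * complex.Im (f2 y)); last first.
    by apply/funext => y; case: (f1 y) (f2 y) => ? ? [].
  exact: (cvgB (cvgM (r1 x) (r2 x)) (cvgM (i1 x) (i2 x))).
- rewrite (_ : (fun y => _) = fun y => complex.Re (f1 y) * complex.Im (f2 y) +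
    complex.Im (f1 y) * complex.Re (f2 y)); last first.
    by apply/funext => y; case: (f1 y) (f2 y) => ? ? [].
  exact: (cvgD (cvgM (r1 x) (i2 x)) (cvgM (i1 x) (r2 x))).
Qed.

Lemma ccontinuous_shift f v : ccontinuous f -> ccontinuous (fun x => f (x + v)).
Proof.
have sc : continuous (fun x : 'rV[R]_n => x + v).
  by move=> x; exact: (cvgD cvg_id (cvg_cst v)).
move=> [rf jf]; split=> x.
- by apply: (@continuous_comp _ _ _ (fun x : 'rV[R]_n => x + v) 
    (fun x => complex.Re (f x))); [exact: sc|exact: rf].
- by apply: (@continuous_comp _ _ _ (fun x : 'rV[R]_n => x + v) 
    (fun x => complex.Im (f x))); [exact: sc|exact: jf].
Qed.

Lemma ccontinuous_sum (I : Type) (s : seq I) (F : I -> 'rV[R]_n -> R[i]) :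
  (forall i, ccontinuous (F i)) -> ccontinuous (fun x => \sum_(i <- s) F i x).
Proof.
move=> Fc; elim: s => [|i s IH].
  by under eq_fun do rewrite big_nil; exact: ccontinuous_cst.
by under eq_fun do rewrite big_cons; exact: ccontinuousD.
Qed.

Lemma torus_integralL z f1 f2 : ccontinuous f1 -> ccontinuous f2 ->
  torus_integral (fun x => z * f1 x + f2 x) =
  z * torus_integral f1 + torus_integral f2.
Proof.
case: z => a b [r1 i1] [r2 i2]; rewrite /torus_integral.
have lin (g1 g2 g3 : 'rV[R]_n -> R) (c1 c2 : R) :
    continuous g1 -> continuous g2 -> continuous g3 ->
    cube_integral (fun x => c1 * g1 x + c2 * g2 x + g3 x) =
    c1 * cube_integral g1 + c2 * cube_integral g2 + cube_integral g3.
  move=> k1 k2 k3.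
  transitivity (1 * cube_integral (fun x => c1 * g1 x + c2 * g2 x) +
      1 * cube_integral g3); last by rewrite cube_integralL// !mul1r.
  rewrite -cube_integralL//; first by under [in RHS]eq_fun do rewrite !mul1r.
  by move=> x; exact: (cvgD (cvgM (cvg_cst c1) (k1 x)) (cvgM (cvg_cst c2) (k2 x))).
rewrite (_ : (fun x => complex.Re _) = fun x => a * complex.Re (f1 x) +
  (- b) * complex.Im (f1 x) + complex.Re (f2 x)); last first.
  by apply/funext => x; case: (f1 x) (f2 x) => ? ? [] ? ? /=; rewrite mulNr.
rewrite (_ : (fun x => complex.Im _) = fun x => a * complex.Im (f1 x) +
  b * complex.Re (f1 x) + complex.Im (f2 x)); last first.
  by apply/funext => x; case: (f1 x) (f2 x) => ? ? [] ? ? /=.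
by rewrite !lin//; apply/eqP; rewrite eq_complex /= mulNr !eqxx.
Qed.

Lemma torus_integral_cst z :
  torus_integral (fun _ : 'rV[R]_n => z) = z * ((2 * pi) ^+ n)%:C.
Proof.
rewrite /torus_integral !cube_integral_cst; case: z => a b.
by apply/eqP; rewrite eq_complex /= !mulr0 subr0 add0r !eqxx.
Qed.

Lemma torus_integral_sum (I : Type) (s : seq I) (c : I -> R[i])
    (F : I -> 'rV[R]_n -> R[i]) : (forall i, ccontinuous (F i)) ->
  torus_integral (fun x => \sum_(i <- s) c i * F i x) =
  \sum_(i <- s) c i * torus_integral (F i).
Proof.
move=> Fc; elim: s => [|i s IH].
  by under eq_fun do rewrite big_nil; rewrite torus_integral_cst mul0r big_nil.
under eq_fun do rewrite big_cons.
rewrite torus_integralL ?IH ?big_cons//; apply: ccontinuous_sum => j.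
by apply: ccontinuousM => //; exact: ccontinuous_cst.
Qed.

Lemma torus_integral_bound f (B : R) : ccontinuous f ->
  (forall x, normc (f x) <= B) ->
  normc (torus_integral f) <= 2 * B * (2 * pi) ^+ n.
Proof.
move=> [rf jf] fB; apply: le_trans (ler_normc_ReIm _) _.
rewrite -mulrA mulr_natl mulr2n; apply: lerD; apply: cube_integral_bound => // x.
- exact: le_trans (ler_Re_normc _) (fB x).
- exact: le_trans (ler_Im_normc _) (fB x).
Qed.

Lemma torus_integral_shift f v : ccontinuous f -> torus_periodic f ->
  torus_integral (fun x => f (x + v)) = torus_integral f.
Proof.
move=> [rf jf] fp; rewrite /torus_integral; congr (_ +i* _).
- by apply: (@cube_integral_shift _ n (fun x => complex.Re (f x))) => // x k; rewrite fp.
- by apply: (@cube_integral_shift _ n (fun x => complex.Im (f x))) => // x k; rewrite fp.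
Qed.

End torus.

(** * Characters *)

Section exponential.
Context {R : realType} {n : nat}.
Implicit Types (xi eta : 'rV[int]_n) (x : 'rV[R]_n).

Lemma cexpD xi x y : cexp xi (x + y) = cexp xi x * cexp xi y.
Proof.
rewrite /cexp linearD cosD sinD; apply/eqP; rewrite eq_complex /=.
by rewrite [X in _ && (_ == X)]addrC !eqxx.
Qed.

Lemma cexp_add xi eta x : cexp xi x * cexp eta x = cexp (xi + eta) x.
Proof.
rewrite /cexp; have -> : idot (xi + eta) x = idot xi x + idot eta x.
  by rewrite /idot -big_split; apply: eq_bigr => i _; rewrite !mxE intrD mulrDr.
rewrite cosD sinD; apply/eqP; rewrite eq_complex /=.
by rewrite [X in _ && (_ == X)]addrC !eqxx.
Qed.

Lemma cexp_freq0 x : cexp 0 x = 1.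
Proof.
rewrite /cexp; have -> : idot 0 x = 0.
  by rewrite /idot big1// => i _; rewrite mxE mulr0.
by rewrite cos0 sin0.
Qed.

Lemma cexp_at0 xi : cexp xi (0 : 'rV[R]_n) = 1.
Proof. by rewrite /cexp linear0 cos0 sin0. Qed.

End exponential.

(** * Second order Taylor bounds *)

Section taylor.
Context {R : realType}.

(** Two applications of the mean value theorem: the quantity to be
    bounded is s (g1 c - g1 0) = s c (g2 d) with 0 < d < c < s. *)
Lemma taylor1_bound (g g1 g2 : R -> R) (B s : R) : 0 < s ->
  (forall t : R, is_derive t (1 : R) g (g1 t)) ->
  (forall t : R, is_derive t (1 : R) g1 (g2 t)) ->
  (forall t, `|g2 t| <= B) ->
  `|g s - g 0 - s * g1 0| <= B * s ^+ 2.
Proof.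
move=> s0 dg dg1 gB.
have cont (k dk : R -> R) (a b : R) : (forall t : R, is_derive t (1 : R) k (dk t)) ->
    {within `[a, b], continuous k}.
  by move=> dk'; apply: derivable_within_continuous => t _; have [] := dk' t.
have [c /[!in_itv]/= /andP[c0 cs] ->] :=
  MVT s0 (fun t _ => dg t) (cont _ _ _ _ dg).
have [d _ E] := MVT c0 (fun t _ => dg1 t) (cont _ _ _ _ dg1).
have -> : g1 c * (s - 0) - s * g1 0 = s * (g1 c - g1 0) by ring.
rewrite E subr0 !normrM (gtr0_norm s0) (gtr0_norm c0) expr2 [leRHS]mulrCA ler_pM2l//.
by rewrite ler_pM// ltW.
Qed.

Lemma is_derive_line n (g : 'rV[R]_n -> R) (v x : 'rV[R]_n) (t : R) :
  derivable g (x + t *: v) v ->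
  is_derive t (1 : R) (fun s : R => g (x + s *: v)) ('D_v g (x + t *: v)).
Proof.
move=> dg; pose k (u : R) := g (u *: v + (x + t *: v)).
have dk : is_derive (0 : R) (1 : R) k ('D_v g (x + t *: v)).
  split; first exact: ((derivable1P _ _ _).1 dg).
  rewrite /derive (_ : (fun u : R => _) = fun u : R =>
    u^-1 *: ((g \o shift (x + t *: v)) (u *: v) - g (x + t *: v)))//.
  by rewrite funeqE => u /=; rewrite /k addr0 [_%:A]mulr1 scale0r add0r.
have -> : (fun s : R => g (x + s *: v)) = fun s => k (s + (- t)).
  by apply/funext => s; rewrite /k addrCA -scalerDl subrK.
by apply: is_derive_shift; rewrite subrr.
Qed.

Lemma taylor_partial n (g : 'rV[R]_n -> R) i (x : 'rV[R]_n) (B s : R) : 0 < s ->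
  smooth g -> (forall y, `|partial i (partial i g) y| <= B) ->
  `|g (x + s *: delta_mx 0 i) - g x - s * partial i g x| <= B * s ^+ 2.
Proof.
move=> s0 sg gB.
have d0 (t : R) : is_derive t (1 : R) (fun t => g (x + t *: delta_mx 0 i))
    (partial i g (x + t *: delta_mx 0 i)).
  by apply: is_derive_line; have [_] := sg [::]; exact.
have d1 (t : R) : is_derive t (1 : R) (fun t => partial i g (x + t *: delta_mx 0 i))
    (partial i (partial i g) (x + t *: delta_mx 0 i)).
  by apply: is_derive_line; have [_] := sg [:: i]; exact.
have := taylor1_bound s0 d0 d1 (fun t => gB _).
by rewrite scale0r addr0.
Qed.

(** As D_i = - i d/dx_i, the partial derivative of f is i D_i f. The factor 2
    comes from estimating real and imaginary parts separately. *)
Lemma taylor_Dpart n (f : 'rV[R]_n -> R[i]) i (x : 'rV[R]_n) (B s : R) : 0 < s ->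
  csmooth f -> (forall y, normc (Dpart i (Dpart i f) y) <= B) ->
  normc (f (x + s *: delta_mx 0 i) - f x - s%:C * (0 +i* 1) * Dpart i f x)
    <= 2 * (B * s ^+ 2).
Proof.
move=> s0 [sr si] fB.
have DDE y : Dpart i (Dpart i f) y =
    - (partial i (partial i (fun y => complex.Re (f y))) y +i*
       partial i (partial i (fun y => complex.Im (f y))) y).
  rewrite {1}/Dpart.
  rewrite [X in partial i X](_ : _ = fun y =>
    0 * partial i (fun y => complex.Re (f y)) y +
    1 * partial i (fun y => complex.Im (f y)) y); last first.
    by apply/funext => w; rewrite /Dpart /=; ring.
  rewrite [X in _ +i* partial i X y](_ : _ = fun y =>
    (-1) * partial i (fun y => complex.Re (f y)) y +
    0 * partial i (fun y => complex.Im (f y)) y); last first.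
    by apply/funext => w; rewrite /Dpart /=; ring.
  rewrite !partialL; [|exact: smooth_partial..].
  move: (partial i (partial i _) y) => p; move: (partial i (partial i _) y) => q.
  by apply/eqP; rewrite eq_complex /=; apply/andP; split; apply/eqP; ring.
have rB y : `|partial i (partial i (fun y => complex.Re (f y))) y| <= B.
  apply: le_trans (fB y); rewrite DDE.
  by apply: le_trans (ler_Re_normc _) => /=; rewrite normrN.
have iB y : `|partial i (partial i (fun y => complex.Im (f y))) y| <= B.
  apply: le_trans (fB y); rewrite DDE.
  by apply: le_trans (ler_Im_normc _) => /=; rewrite normrN.
apply: le_trans (ler_normc_ReIm _) _.
rewrite mulr_natl mulr2n; apply: lerD.
- apply: le_trans (taylor_partial x s0 sr rB); rewrite le_eqVlt; apply/orP; left.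
  apply/eqP; congr (`|_|); rewrite /Dpart.
  by case: (f x) (f _) => ? ? [] ? ? /=; ring.
- apply: le_trans (taylor_partial x s0 si iB); rewrite le_eqVlt; apply/orP; left.
  apply/eqP; congr (`|_|); rewrite /Dpart.
  by case: (f x) (f _) => ? ? [] ? ? /=; ring.
Qed.

End taylor.

(** * Pairing with a character *)

Section pairing.
Context {R : realType} {n : nat}.
Implicit Types (f : 'rV[R]_n -> R[i]) (xi : 'rV[int]_n) (i : 'I_n).

(** This is (2 pi)^n times the Fourier coefficient of f at the frequency
    - xi. *)
Definition pairing xi f : R[i] := torus_integral (fun x => cexp xi x * f x).

Lemma cexp_ccontinuous xi : ccontinuous (cexp xi : 'rV[R]_n -> R[i]).
Proof. exact/csmooth_continuous/cexp_csmooth. Qed.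

Lemma pairingL xi z f1 f2 : ccontinuous f1 -> ccontinuous f2 ->
  pairing xi (fun x => z * f1 x + f2 x) = z * pairing xi f1 + pairing xi f2.
Proof.
move=> c1 c2; rewrite -torus_integralL; try exact: ccontinuousM (cexp_ccontinuous xi) _.
by congr torus_integral; apply/funext => x; ring.
Qed.

Lemma pairing_bound xi f (B : R) : ccontinuous f ->
  (forall x, normc (f x) <= B) -> normc (pairing xi f) <= 2 * B * (2 * pi) ^+ n.
Proof.
move=> fc fB; apply: torus_integral_bound => [|x].
  exact: ccontinuousM (cexp_ccontinuous xi) fc.
by rewrite normcM normc_cexp mul1r.
Qed.

(** Translation invariance of the integral moves the translation from f to
    the character, where it becomes a factor. *)
Lemma pairing_shift xi f v : ccontinuous f -> torus_periodic f ->
  pairing xi (fun x => f (x + v)) = cexp (- xi) v * pairing xi f.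
Proof.
move=> fc fp; have ec := ccontinuousM (cexp_ccontinuous xi) fc.
rewrite /pairing -[in RHS](@torus_integral_shift _ _ _ v ec); last first.
  by move=> x k; rewrite fp cexp_periodic.
rewrite -[RHS]addr0 -[X in _ + X](mul0r (((2 * pi) ^+ n)%:C)) -torus_integral_cst.
rewrite -torus_integralL; [|exact: (ccontinuous_shift v ec)|exact: ccontinuous_cst].
congr torus_integral; apply/funext => x; rewrite addr0 cexpD.
have : cexp (- xi) v * cexp xi v = 1 by rewrite cexp_add addNr cexp_freq0.
by move=> E; rewrite -[LHS]mul1r -E; ring.
Qed.

Lemma torus_periodic_Dpart i f : torus_periodic f -> torus_periodic (Dpart i f).
Proof.
move=> fp x k; rewrite /Dpart /partial.
have P (g : 'rV[R]_n -> R) v : periodic_rV g ->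
    'D_v g (x + (2 * pi) *: map_mx intr k) = 'D_v g x.
  move=> gp; rewrite /derive (_ : (fun u : R => _) = fun u : R =>
    u^-1 *: ((g \o shift x) (u *: v) - g x))//.
  by rewrite funeqE => u /=; rewrite addrA !gp.
by rewrite !P// => y l /=; rewrite fp.
Qed.

Lemma torus_periodic_iterD m i f :
  torus_periodic f -> torus_periodic (iter m (Dpart i) f).
Proof. by move=> fp; elim: m => //= m; exact: torus_periodic_Dpart. Qed.

Lemma Dmulti_single i m f :
  Dmulti (fun j => if j == i then m else 0%N) f = iter m (Dpart i) f.
Proof.
rewrite /Dmulti; have := enum_uniq 'I_n; have := mem_enum 'I_n i; rewrite inE.
elim: (enum 'I_n) => // j s IH; rewrite inE /= => jsi /andP[js us].
have [ij|ij] := eqVneq j i.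
  subst j; congr iter; elim: s js {IH jsi us} => //= j s IH.
  by rewrite inE negb_or eq_sym => /andP[/negPf -> /IH].
by rewrite IH//; move: jsi; rewrite eq_sym (negPf ij).
Qed.

Lemma msize_single i m : msize (fun j : 'I_n => if j == i then m else 0%N) = m.
Proof. by rewrite /msize -big_mkcond big_pred1_eq. Qed.

Lemma Dpart_cexp1 i xi : Dpart i (cexp xi) =
  fun x : 'rV[R]_n => ((xi 0 i)%:~R : R)%:C * cexp xi x.
Proof.
have := @Dpart_cexp R n i xi 1; rewrite mul1r => <-.
by congr Dpart; apply/funext => x; rewrite mul1r.
Qed.

Lemma normc_Dpart2_cexp i xi (x : 'rV[R]_n) :
  normc (Dpart i (Dpart i (cexp xi)) x) <= ((xi 0 i)%:~R : R) ^+ 2.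
Proof.
rewrite Dpart_cexp1 Dpart_cexp normcM normc_cexp mulr1 normcR -expr2.
by rewrite ger0_norm ?sqr_ge0.
Qed.

(** Compare the first order terms in s of the two sides of [pairing_shift] for
    v = s e_i. Let r and rho be the Taylor remainders of f and of the factor,
    and w the difference of the two sides of the claim. The equality [key]
    expresses s w in terms of the remainders, whence |w| <= s K; letting s
    tend to 0 gives w = 0. *)
Lemma pairing_Dpart xi i f (B : R) : csmooth f -> torus_periodic f ->
  (forall x, normc (Dpart i (Dpart i f) x) <= B) ->
  pairing xi (Dpart i f) = - (xi 0 i)%:~R * pairing xi f.
Proof.
move=> fs fp fB.
pose d : 'rV[R]_n := delta_mx 0 i; pose J : R[i] := 0 +i* 1.
pose z : R[i] := ((xi 0 i)%:~R : R)%:C.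
have zE : z = (xi 0 i)%:~R by rewrite /z rmorph_int.
have fc := csmooth_continuous fs.
have Dc := csmooth_continuous (csmooth_Dpart i fs).
pose r (s : R) x := f (x + s *: d) - f x - s%:C * J * Dpart i f x.
pose rho (s : R) : R[i] := cexp (- xi) (s *: d) - 1 + s%:C * J * z.
have rhoB (s : R) : 0 < s ->
    normc (rho s) <= 2 * (((xi 0 i)%:~R : R) ^+ 2 * s ^+ 2).
  move=> s0.
  have := @taylor_Dpart R n (cexp (- xi)) i 0 _ s s0 (cexp_csmooth _ _)
    (fun y => normc_Dpart2_cexp _ _ y).
  rewrite add0r cexp_at0 Dpart_cexp1 cexp_at0 mulr1 mxE rmorphN sqrrN.
  by rewrite /rho /z rmorphN mulrN opprK.
have key (s : R) : s%:C * J * (z * pairing xi f + pairing xi (Dpart i f)) =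
    rho s * pairing xi f - pairing xi (r s).
  have -> : pairing xi (r s) = (cexp (- xi) (s *: d) - 1) * pairing xi f -
      s%:C * J * pairing xi (Dpart i f).
    have c1 := ccontinuous_shift (s *: d) fc.
    have c2 : ccontinuous (fun x => -1 * f x + f (x + s *: d)).
      by apply: ccontinuousD c1; apply: ccontinuousM => //; exact: ccontinuous_cst.
    have -> : r s = fun x => - (s%:C * J) * Dpart i f x + (-1 * f x + f (x + s *: d)).
      by apply/funext => x; rewrite /r; ring.
    rewrite pairingL// pairingL// pairing_shift//; ring.
  rewrite /rho; ring.
pose w := z * pairing xi f + pairing xi (Dpart i f).
pose K := 2 * ((xi 0 i)%:~R : R) ^+ 2 * normc (pairing xi f) + 4 * B * (2 * pi) ^+ n.
have wB (s : R) : 0 < s -> normc w <= s * K.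
  move=> s0; rewrite -(ler_pM2l s0).
  have -> : s * normc w = normc (s%:C * J * w).
    rewrite !normcM normcR gtr0_norm//.
    by rewrite /J /= expr0n expr1n add0r sqrtr1 mulr1.
  rewrite /w key; apply: le_trans (ler_normcD _ _) _.
  rewrite normcN normcM /K.
  have rc : ccontinuous (r s).
    apply: ccontinuousD; [apply: ccontinuousD|].
    - exact: ccontinuous_shift.
    - have := ccontinuousM (ccontinuous_cst (-1)) fc.
      by under eq_fun do rewrite mulN1r.
    - have := ccontinuousM (ccontinuous_cst (- (s%:C * J))) Dc.
      by under eq_fun do rewrite mulNr.
  have rB := pairing_bound xi rc (fun x => taylor_Dpart x s0 fs fB).
  have p0 := normc_ge0 (pairing xi f).
  have := ler_wpM2r p0 (rhoB s s0).
  move: rB; set X := normc (pairing xi (r s)); set Y := normc (rho s) * _.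
  by move=> XB YB; apply: le_trans (lerD YB XB) _; rewrite le_eqVlt; apply/orP; left; apply/eqP; ring.
have w0 : normc w = 0.
  apply/eqP; rewrite eq_le normc_ge0 andbT; apply/ler_addgt0Pr => e e0; rewrite add0r.
  have K1 : 0 < `|K| + 1 by rewrite ltr_wpDl.
  have := wB (e / (`|K| + 1)) (divr_gt0 e0 K1); move/le_trans; apply.
  rewrite -mulrA ler_piMr ?(ltW e0)// mulrC ler_pdivrMr// mul1r.
  by apply: le_trans (ler_norm K) _; rewrite lerDl.
have /eqP := eq0_normc w0.
by rewrite /w addrC addr_eq0 => /eqP ->; rewrite zE mulNr.
Qed.

Lemma pairing_iterD xi i f m : csmooth f -> torus_periodic f ->
  (forall k, exists B : R, forall x, normc (iter k (Dpart i) f x) <= B) ->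
  pairing xi (iter m (Dpart i) f) = (- (xi 0 i)%:~R) ^+ m * pairing xi f.
Proof.
move=> fs fp fB; elim: m => [|m IH]; first by rewrite mul1r.
have [B DB] := fB m.+2.
rewrite iterS (@pairing_Dpart _ _ _ B) ?IH ?exprS ?mulrA//.
- exact: csmooth_iterD.
- exact: torus_periodic_iterD.
Qed.

(** Both [pairing_Dpart] and the eigenvalue equation of the character compute
    the pairing with D_i (cexp (- eta)); the two factors differ at a
    coordinate i where xi and eta differ. *)
Lemma pairing_cexp xi eta : xi != eta -> pairing xi (cexp (- eta)) = 0.
Proof.
move=> xe; have [i xi_i] : exists i, xi 0 i != eta 0 i.
  apply: contra_neqP xe => /forallNP H; apply/rowP => i.
  by apply/eqP/negPn/negP; exact: H.
have := pairing_Dpart xi (cexp_csmooth _ (- eta)) (cexp_periodic _)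
  (normc_Dpart2_cexp i (- eta)).
rewrite Dpart_cexp1 mxE rmorphN.
have -> : pairing xi (fun x : 'rV[R]_n => (- (eta 0 i)%:~R : R)%:C * cexp (- eta) x) =
    (- (eta 0 i)%:~R) * pairing xi (cexp (- eta)).
  have := pairingL xi (- (eta 0 i)%:~R : R)%:C (cexp_ccontinuous (- eta))
    (ccontinuous_cst 0).
  under [in LHS]eq_fun do rewrite addr0.
  move=> ->; rewrite rmorphN rmorph_int.
  suff -> : pairing xi (fun=> 0) = 0 by rewrite addr0.
  rewrite /pairing; under eq_fun do rewrite mulr0.
  by rewrite torus_integral_cst mul0r.
move/eqP; rewrite -subr_eq0 -mulrBl mulf_eq0 => /orP[|/eqP//].
by rewrite opprK addrC subr_eq0 eqr_int (negPf xi_i).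
Qed.

Lemma pairing_cexp_diag xi : pairing xi (cexp (- xi)) = ((2 * pi) ^+ n)%:C.
Proof.
rewrite /pairing; under eq_fun do rewrite cexp_add subrr cexp_freq0.
by rewrite torus_integral_cst mul1r.
Qed.

End pairing.

(** * Decay of the terms *)

Section decay.
Context {R : realType} {N : nat}.
Implicit Types (f : 'rV[R]_N -> R[i]) (xi : 'rV[int]_N).

(** The binomial coefficient is a term of the expansion of (1 + 1)^(m + d). *)
Lemma leq_fact_add m d : ((m + d)`! <= 2 ^ (m + d) * (m`! * d`!))%N.
Proof.
rewrite -(@bin_fact (m + d) m) ?leq_addr// addKn leq_mul2r; apply/orP; right.
have := Pascal 1 1 (m + d); rewrite addn1 => ->.
have mlt : (m < (m + d).+1)%N by rewrite ltnS leq_addr.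
by rewrite (bigD1 (Ordinal mlt))//= !exp1n !muln1 leq_addr.
Qed.

Lemma enorm_ge0 xi : 0 <= enorm R xi.
Proof. exact: sqrtr_ge0. Qed.

Lemma coord_le_enorm xi i : `|(xi 0 i)%:~R : R| <= enorm R xi.
Proof.
rewrite /enorm -sqrtr_sqr ler_wsqrtr// (bigD1 i)//= lerDl.
by apply: sumr_ge0 => j _; exact: sqr_ge0.
Qed.

(** For i a coordinate of largest modulus, |xi| <= N |xi_i|. The maximum with 1
    covers xi = 0. *)
Lemma enorm_le_coord xi : (1 <= N)%N -> exists i,
  1 + enorm R xi <= N.+1%:R * Num.max 1 `|(xi 0 i)%:~R : R|.
Proof.
move=> N1; pose i0 := Ordinal N1.
case: (@arg_maxnP _ i0 xpredT (fun i => absz (xi 0 i)) isT) => i _ imax.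
exists i; set m := `|(xi 0 i)%:~R : R|.
have m0 : 0 <= m by exact: normr_ge0.
have : enorm R xi <= N%:R * m.
  rewrite -[leRHS]ger0_norm ?mulr_ge0 ?ler0n// -sqrtr_sqr ler_wsqrtr//.
  apply: (@le_trans _ _ (\sum_(j < N) m ^+ 2)).
    apply: ler_sum => j _; rewrite -[leLHS]real_normK ?num_real//.
    rewrite lerXn2r ?nnegrE// /m -!intr_norm ler_int -!abszE lez_nat.
    exact: imax.
  rewrite sumr_const card_ord -[leLHS]mulr_natl exprMn ler_wpM2r ?sqr_ge0//.
  by rewrite -natrX ler_nat -mulnn leq_pmull.
have : 1 <= Num.max 1 m by rewrite le_max lexx.
have : m <= Num.max 1 m by rewrite le_max lexx orbT.
set w := Num.max 1 m => mw w1 eN.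
rewrite -addn1 natrD mulrDl mul1r addrC lerD//.
by apply: le_trans eN _; rewrite ler_wpM2l ?ler0n.
Qed.

Variable M : weightSeq R.

(** The inequality [ultra_norm M t f <= r] without the supremum, for functions
    that need not be packaged as elements of the space. *)
Definition deriv_bound (t r : R) f := forall x al,
  normc (Dmulti al f x) <= r * (t ^+ msize al * M (msize al) * (msize al)`!%:R).

Lemma pairing_coord (t r : R) f xi i m : csmooth f -> torus_periodic f ->
  deriv_bound t r f ->
  `|(xi 0 i)%:~R : R| ^+ m * normc (pairing xi f) <=
  2 * (2 * pi) ^+ N * r * (t ^+ m * M m * m`!%:R).
Proof.
move=> fs fp fB.
have itB k x : normc (iter k (Dpart i) f x) <= r * (t ^+ k * M k * k`!%:R).
  by have := fB x (fun j => if j == i then k else 0%N);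
    rewrite Dmulti_single msize_single.
have E := pairing_iterD xi m fs fp (fun k => ex_intro _ _ (itB k)).
have := pairing_bound xi (csmooth_continuous (csmooth_iterD m i fs)) (itB m).
rewrite E normcM (_ : normc _ = `|(xi 0 i)%:~R : R| ^+ m); last first.
  have -> : - (xi 0 i)%:~R = (- (xi 0 i)%:~R : R)%:C :> R[i].
    by rewrite rmorphN rmorph_int.
  by rewrite -rmorphXn normcR normrX normrN.
by move/le_trans; apply; rewrite le_eqVlt; apply/orP; left; apply/eqP; ring.
Qed.

Lemma deriv_bound_ge0 (t r : R) f : deriv_bound t r f -> 0 <= r.
Proof.
move=> /(_ 0 (fun=> 0%N)); rewrite (_ : msize _ = 0%N); last first.
  by rewrite /msize big1.
rewrite expr0 weight0 fact0 !mulr1; apply: le_trans; exact: normc_ge0.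
Qed.

(** [pairing_coord] at the coordinate given by [enorm_le_coord]. If its modulus
    is at most 1, the case m = 0 of [pairing_coord] suffices, the right-hand
    side being larger than for m = 0: this is why t is replaced by 1 + t. *)
Lemma pairing_decay (t r : R) f xi m : (1 <= N)%N -> 0 < t ->
  csmooth f -> torus_periodic f -> deriv_bound t r f ->
  (1 + enorm R xi) ^+ m * normc (pairing xi f) <=
  2 * (2 * pi) ^+ N * r * ((N.+1%:R * (1 + t)) ^+ m * M m * m`!%:R).
Proof.
move=> N1 t0 fs fp fB; have [i ei] := enorm_le_coord xi N1.
have r0 := deriv_bound_ge0 fB.
have A0 : 0 <= 2 * (2 * pi) ^+ N * r.
  by rewrite !mulr_ge0// exprn_ge0// mulr_ge0// pi_ge0.
have T0 := normc_ge0 (pairing xi f).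
have e1 : 0 <= 1 + enorm R xi by rewrite addr_ge0 ?enorm_ge0.
have Mm := weight_ge1 M m; have M0 := weight_gt0 M m.
have f1 : 1 <= m`!%:R :> R by rewrite ler1n fact_gt0.
suff maxB : Num.max 1 `|(xi 0 i)%:~R : R| ^+ m * normc (pairing xi f) <=
    2 * (2 * pi) ^+ N * r * ((1 + t) ^+ m * M m * m`!%:R).
  apply: (@le_trans _ _ (N.+1%:R ^+ m * (Num.max 1 `|(xi 0 i)%:~R : R| ^+ m *
    normc (pairing xi f)))).
    by rewrite mulrA -exprMn ler_wpM2r// lerXn2r// nnegrE (le_trans e1 ei).
  have -> : 2 * (2 * pi) ^+ N * r * ((N.+1%:R * (1 + t)) ^+ m * M m * m`!%:R) =
      N.+1%:R ^+ m * (2 * (2 * pi) ^+ N * r * ((1 + t) ^+ m * M m * m`!%:R)).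
    by rewrite (exprMn m); ring.
  by rewrite ler_wpM2l// exprn_ge0 ?ler0n.
have [z1|z1] := leP `|(xi 0 i)%:~R : R| 1.
  rewrite expr1n mul1r.
  have := pairing_coord xi i 0 fs fp fB; rewrite !expr0 mul1r weight0 fact0 !mulr1.
  move/le_trans; apply; rewrite -[leLHS]mulr1 ler_wpM2l//.
  rewrite -[leLHS]mulr1 ler_pM// -[leLHS]mulr1 ler_pM//.
  by rewrite exprn_ege1// lerDl ltW.
apply: le_trans (pairing_coord xi i m fs fp fB) _.
rewrite ler_wpM2l// ler_wpM2r// ler_wpM2r ?(ltW M0)//.
by rewrite lerXn2r ?nnegrE ?lerDr// ?ltW// addr_gt0.
Qed.

Variable a : 'rV[int]_N -> R[i].
Hypothesis a_bound : forall eps : R, 0 < eps -> exists2 C : R, 0 < C &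
  forall xi : 'rV[int]_N,
    ((normc (a xi))%:E <= C%:E * ereal_sup
      [set (eps ^+ n * (1 + enorm R xi) ^+ n / (M n * n`!%:R))%:E
         | n in [set: nat]])%E.

(** The terms of the supremum in [a_bound], for eps = 1 / L, are the factors
    that [pairing_decay] can absorb at the order m + d; the d powers of
    1 + |xi| set aside make the series summable. *)
Lemma term_bound (t : R) : (1 <= N)%N -> 0 < t -> exists2 Q : R, 0 < Q &
  forall f r xi, csmooth f -> torus_periodic f -> deriv_bound t r f ->
  normc (a xi * pairing xi f) * (1 + enorm R xi) ^+ N.+2 <= Q * r.
Proof.
move=> N1 t0; have [H H1 MH] := weight_stable M.
pose d := N.+2; pose K : R := N.+1%:R * (1 + t); pose L := 2 * K * H.
pose A : R := 2 * (2 * pi) ^+ N.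
have H0 : 0 < H by apply: lt_trans H1.
have K0 : 0 < K by rewrite mulr_gt0 ?ltr0n// addr_gt0.
have L0 : 0 < L by apply: mulr_gt0 => //; exact: mulr_gt0.
have A0 : 0 < A by rewrite mulr_gt0// exprn_gt0// mulr_gt0// pi_gt0.
have Li0 : 0 < L^-1 by rewrite invr_gt0.
have [C C0 aC] := a_bound Li0.
pose D := A * (L ^+ d * M d * d`!%:R).
have D0 : 0 < D by rewrite mulr_gt0// denom_gt0.
exists (C * D) => [|f r xi fs fp fB]; first exact: mulr_gt0.
have r0 := deriv_bound_ge0 fB.
set e := 1 + enorm R xi; set T := normc (pairing xi f).
have e0 : 0 < e by rewrite ltr_pwDl ?enorm_ge0.
have T0 : 0 <= T := normc_ge0 _.
have step m : L^-1 ^+ m * e ^+ m / (M m * m`!%:R) * (e ^+ d * T) <= D * r.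
  have Mm0 := weight_gt0 M m; have Md0 := weight_gt0 M d.
  have P0 : 0 < M m * m`!%:R by rewrite mulr_gt0// ltr0n fact_gt0.
  have Lm0 : 0 < L ^+ m by rewrite exprn_gt0.
  have -> : L^-1 ^+ m * e ^+ m / (M m * m`!%:R) * (e ^+ d * T) =
      (e ^+ (m + d) * T) / (L ^+ m * (M m * m`!%:R)).
    move: P0 Lm0; rewrite exprVn exprD; move: (M m * _) (L ^+ m) => P l P0 l0.
    by field; rewrite !gt_eqF.
  rewrite ler_pdivrMr ?mulr_gt0//.
  apply: le_trans (pairing_decay xi (m + d) N1 t0 fs fp fB) _.
  have -> : D * r * (L ^+ m * (M m * m`!%:R)) =
      A * r * ((K ^+ (m + d) * (H ^+ (m + d) * M m * M d)) *
               (2 ^+ (m + d) * (m`!%:R * d`!%:R))).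
    by rewrite /D /L !exprMn !exprD; ring.
  apply: (ler_wpM2l (mulr_ge0 (ltW A0) r0)); apply: ler_pM => //.
  - by rewrite mulr_ge0 ?exprn_ge0 ?(ltW K0)// ltW// weight_gt0.
  - by rewrite ler_wpM2l ?exprn_ge0 ?(ltW K0).
  - by rewrite -natrX -!natrM ler_nat leq_fact_add.
have [TT|TT] := eqVneq T 0.
  rewrite normcM -/T TT mulr0 mul0r; exact: mulr_ge0 (mulr_ge0 (ltW C0) (ltW D0)) r0.
have Tp : 0 < T by rewrite lt_neqAle eq_sym TT.
have eT : 0 < e ^+ d * T by rewrite mulr_gt0// exprn_gt0.
have : normc (a xi) <= C * (D * r / (e ^+ d * T)).
  rewrite -lee_fin; apply: le_trans (aC xi) _.
  rewrite EFinM lee_wpmul2l ?lee_fin ?(ltW C0)//.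
  by apply: ge_ereal_sup => _ [m _ <-]; rewrite lee_fin ler_pdivlMr.
rewrite mulrA ler_pdivlMr// => aB.
by rewrite normcM -/T -mulrA [T * _]mulrC -[C * D * r]mulrA.
Qed.

End decay.

(** * Sums over lattice balls *)

Section lattice_sums.
Context {R : realType} {N : nat}.
Implicit Types (xi : 'rV[int]_N) (F : 'rV[int]_N -> R[i]).

Definition lattice_ball j := [set xi : 'rV[int]_N | enorm R xi <= j%:R].

Definition box_points j : seq 'rV[int]_N :=
  [seq \row_i (Posz (k i) - Posz j) | k : {ffun 'I_N -> 'I_(2 * j).+1}].

Lemma lattice_ball_box j xi : lattice_ball j xi -> xi \in box_points j.
Proof.
rewrite /lattice_ball /= => xij.
have le_j i : (absz (xi 0%R i) <= j)%N.
  have := le_trans (coord_le_enorm xi i) xij.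
  by rewrite -intr_norm -[j%:R]/(j%:Z%:~R) ler_int -abszE lez_nat.
apply/mapP; exists [ffun i => inord (absz (xi 0 i + Posz j))]; first by rewrite mem_enum.
apply/rowP => i; rewrite mxE ffunE; have := le_j i; move: (xi 0 i) => z zj.
rewrite inordK; first by lia.
by lia.
Qed.

Lemma finite_lattice_ball j : finite_set (lattice_ball j).
Proof.
apply: (@sub_finite_set _ _ [set` box_points j]); last exact: finite_seq.
by move=> xi /lattice_ball_box.
Qed.

Lemma mem_lattice_ball j xi :
  (xi \in fset_set (lattice_ball j)) = (enorm R xi <= j%:R).
Proof.
rewrite in_fset_set; last exact: finite_lattice_ball.
by apply/idP/idP => [/set_mem|] // H; exact: mem_set.
Qed.

Lemma size_lattice_ball j :
  (size (fset_set (lattice_ball j)) <= (2 * j).+1 ^ N)%N.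
Proof.
have -> : ((2 * j).+1 ^ N)%N = size (box_points j).
  by rewrite size_image card_ffun !card_ord.
apply: uniq_leq_size; first exact: fset_uniq.
by move=> xi; rewrite mem_lattice_ball => /lattice_ball_box.
Qed.

Lemma normc_sum (I : eqType) (s : seq I) (P : pred I) (G : I -> R[i]) (B : R) :
  0 <= B -> (forall i, P i -> i \in s -> normc (G i) <= B) ->
  normc (\sum_(i <- s | P i) G i) <= (size s)%:R * B.
Proof.
move=> B0; elim: s => [|i s IH] GB; first by rewrite big_nil normc0 mul0r.
rewrite big_cons /= -addn1 natrD mulrDl mul1r [leRHS]addrC.
have {}IH := IH (fun j Pj js => GB j Pj (@mem_behead _ (i :: s) j js)).
case: ifP => Pi; last by apply: le_trans IH _; rewrite lerDr.
apply: le_trans (ler_normcD _ _) _; apply: lerD => //.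
by apply: GB => //; rewrite mem_head.
Qed.

Definition ball_sum F j : R[i] := \sum_(xi <- fset_set (lattice_ball j)) F xi.

Section decaying.
Variables (F : 'rV[int]_N -> R[i]) (Q : R).
Hypothesis FQ : forall xi, normc (F xi) * (1 + enorm R xi) ^+ N.+2 <= Q.

Let Q0 : 0 <= Q.
Proof.
apply: le_trans (FQ 0); rewrite mulr_ge0 ?normc_ge0 ?exprn_ge0//.
by rewrite addr_ge0 ?enorm_ge0.
Qed.

Lemma normc_decay j xi : j%:R <= enorm R xi -> normc (F xi) <= Q / j.+1%:R ^+ N.+2.
Proof.
move=> jxi; rewrite ler_pdivlMr ?exprn_gt0 ?ltr0n//.
apply: le_trans (FQ xi); rewrite ler_wpM2l ?normc_ge0//.
by rewrite lerXn2r ?nnegrE ?ler0n ?addr_ge0 ?enorm_ge0// -addn1 natrD addrC lerD2l.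
Qed.

Lemma ball_sum0_bound : normc (ball_sum F 0) <= Q.
Proof.
have nQ xi : normc (F xi) <= Q.
  have := @normc_decay 0 xi (enorm_ge0 xi); by rewrite expr1n divr1.
apply: le_trans (normc_sum (B := Q) Q0 _) _; first by move=> xi _ _.
rewrite ler_piMl// -[1]/(1%:R) ler_nat.
by have := size_lattice_ball 0; rewrite muln0 exp1n.
Qed.

(** The points of the shell j < |xi| <= j + 1 are at most
    (2 j + 3)^N <= 3^N (j + 1)^N in number, and each term is at most
    Q (j + 1)^(- N - 2). *)
Lemma ball_sum_step j :
  normc (ball_sum F j.+1 - ball_sum F j) <= 3 ^+ N * Q / j.+1%:R ^+ 2.
Proof.
have -> : ball_sum F j.+1 - ball_sum F j =
    \sum_(xi <- fset_set (lattice_ball j.+1) | ~~ (enorm R xi <= j%:R)) F xi.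
  rewrite {1}/ball_sum (bigID (fun xi => enorm R xi <= j%:R))/=.
  rewrite [X in X + _ - _](_ : _ = ball_sum F j) 1?addrC ?addKr//.
  rewrite -big_filter; apply: perm_big; apply: uniq_perm.
  - by rewrite filter_uniq// fset_uniq.
  - exact: fset_uniq.
  move=> xi; rewrite mem_filter !mem_lattice_ball.
  apply/andP/idP => [[]//|xij]; split=> //; apply: le_trans xij _.
  by rewrite ler_nat.
have P0 : 0 < (j.+1%:R : R) by rewrite ltr0n.
apply: le_trans (normc_sum (B := Q / j.+1%:R ^+ N.+2) _ _) _.
- by rewrite divr_ge0// exprn_ge0// ltW.
- by move=> xi; rewrite -ltNge => /ltW ? _; exact: normc_decay.
rewrite ler_pdivlMr ?exprn_gt0//; set S := size _.
have -> : S%:R * (Q / j.+1%:R ^+ N.+2) * j.+1%:R ^+ 2 = S%:R * Q / j.+1%:R ^+ N.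
  by rewrite -addn2 exprD; field; rewrite !expf_neq0 ?gt_eqF.
rewrite ler_pdivrMr ?exprn_gt0// [leRHS]mulrAC ler_wpM2r//.
rewrite -exprMn -natrM; apply: (@le_trans _ _ ((2 * j.+1).+1%:R ^+ N)).
  by rewrite -natrX ler_nat size_lattice_ball.
rewrite lerXn2r ?nnegrE ?ler0n// ler_nat; lia.
Qed.

(** The bounds of [ball_sum_step] are dominated by a telescoping sum:
    1 / l^2 <= 2 (1 / l - 1 / (l + 1)) for l >= 1. *)
Lemma ball_sum_cauchy j k : (j <= k)%N ->
  normc (ball_sum F k - ball_sum F j) <= 2 * 3 ^+ N * Q / j.+1%:R.
Proof.
move=> /subnK <-; move: (k - j)%N => {k} m.
have W0 : 0 <= 2 * 3 ^+ N * Q by rewrite !mulr_ge0 ?exprn_ge0.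
apply: (@le_trans _ _ (2 * 3 ^+ N * Q * (j.+1%:R^-1 - (m + j).+1%:R^-1))); last first.
  by rewrite ler_wpM2l// gerBl invr_ge0 ler0n.
elim: m => [|m IH]; first by rewrite add0n !subrr normc0 mulr0.
rewrite (_ : _ - _ = (ball_sum F (m.+1 + j) - ball_sum F (m + j)) +
  (ball_sum F (m + j) - ball_sum F j)); last by rewrite addrA subrK.
apply: le_trans (ler_normcD _ _) _.
apply: le_trans (lerD (ball_sum_step _) IH) _.
set p := (m + j)%N; rewrite addSn -/p.
have p0 : 0 < (p.+1%:R : R) by rewrite ltr0n.
have p1 : 1 <= (p.+1%:R : R) by rewrite ler1n.
have -> : p.+2%:R = p.+1%:R + 1 :> R by rewrite -addn1 natrD.
move: p0 p1; move: (p.+1%:R : R) => x x0 x1.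
have H : (x ^+ 2)^-1 <= 2 * (x^-1 - (x + 1)^-1).
  rewrite -subr_ge0.
  have -> : 2 * (x^-1 - (x + 1)^-1) - (x ^+ 2)^-1 = (x - 1) / (x ^+ 2 * (x + 1)).
    by field; apply/andP; split; lra.
  by rewrite divr_ge0 ?subr_ge0// mulr_ge0 ?exprn_ge0 ?addr_ge0// ltW.
have := ler_wpM2l (mulr_ge0 (exprn_ge0 N (ler0n R 3)) Q0) H.
move: (j.+1%:R^-1 : R) => y; move: (x ^+ 2)^-1 x^-1 (x + 1)^-1 => u v w.
have -> : 2 * 3 ^+ N * Q = 2 * (3 ^+ N * Q) by rewrite mulrA.
move: (3 ^+ N * Q) => c'.
nra.
Qed.

End decaying.

End lattice_sums.

(** * Limits of bounded forms *)

Section limits.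
Context {R : realType}.

Lemma cvg_of_rate (x : nat -> R) (W : R) :
  (forall j k, (j <= k)%N -> `|x k - x j| <= W / j.+1%:R) -> cvgn x.
Proof.
move=> xW; apply/cauchy_cvgP/cauchy_exP => e e0.
have W1 : 0 < `|W| + 1 by rewrite ltr_wpDl.
have [j _ /(_ j (leqnn j)) /= jW] :=
  (cvgryPgt (fun j : nat => j%:R : R)).1 (@cvgr_idn R) ((`|W| + 1) / e).
exists (x j), j => // k /= jk; rewrite /ball/= distrC.
apply: le_lt_trans (xW j k jk) _; rewrite ltr_pdivrMr ?ltr0n//.
move: jW; rewrite ltr_pdivrMr// => jW.
apply: le_lt_trans (ler_norm W) _; apply: (@lt_trans _ _ (j%:R * e)).
  by apply: lt_trans jW; rewrite ltrDl.
by rewrite mulrC (ltr_pM2l e0) ltr_nat.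
Qed.

Lemma cvg_complex (s : nat -> R[i]) (x y : R) :
  (fun j => complex.Re (s j)) @ \oo --> x ->
  (fun j => complex.Im (s j)) @ \oo --> y ->
  (s : nat -> R[i]^o) @ \oo --> (x +i* y : R[i]^o).
Proof.
move=> sx sy; apply/cvgrPdist_lt => -[e e'] /=; rewrite ltcE /= => /andP[/eqP -> e0].
have e20 : 0 < e / 2 by rewrite divr_gt0.
have /cvgrPdist_lt/(_ _ e20) sx2 := sx.
have /cvgrPdist_lt/(_ _ e20) sy2 := sy.
near=> j; rewrite Defs.normcE -[ltRHS]/(e%:C) ltcR.
apply: le_lt_trans (ler_normc_ReIm _) _.
rewrite [e]splitr; apply: ltrD.
- have : `|x - complex.Re (s j)| < e / 2 by near: j.
  by case: (s j).
- have : `|y - complex.Im (s j)| < e / 2 by near: j.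
  by case: (s j).
Unshelve. all: by end_near. Qed.

Lemma complex_cvg_unique (s : nat -> R[i]) (z w : R[i]) :
  (s : nat -> R[i]^o) @ \oo --> (z : R[i]^o) ->
  (s : nat -> R[i]^o) @ \oo --> (w : R[i]^o) -> z = w.
Proof. by move=> sz sw; apply: (cvg_unique (@norm_hausdorff _ R[i]^o) sz sw). Qed.

End limits.

Section functionals.
Context {R : realType} {N : nat} {M : weightSeq R} {h : radii R}.
Local Notation E := (ultradiff N M h).

(** Bounded on each step E_(M, h m) of the inductive limit. *)
Definition step_bounded (u : E -> R[i]) := forall m, exists2 Q : R, 0 < Q &
  forall (f : E) (r : R), (ultra_norm M (h m) f <= r%:E)%E -> normc (u f) <= Q * r.

(** The set where |u| <= e / 2 is absolutely convex, and it contains a ball of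
    each step by the bound on that step: it is a basic neighbourhood of 0. *)
Lemma step_bounded_continuous (u : {scalar E}) : step_bounded u ->
  continuous (u : E -> R[i]^o).
Proof.
move=> uQ f A /= /nbhs_ballP[[e e'] /=]; rewrite ltcE /= => /andP[/eqP -> e0] eA.
have e20 : 0 < e / 2 by rewrite divr_gt0.
apply/ind_nbhsP; exists [set g | normc (u g) <= e / 2].
  split=> [g k b c bc /= ug uk|m].
    rewrite linearD !linearZ /=; apply: le_trans (ler_normcD _ _) _; rewrite !normcM.
    apply: (@le_trans _ _ ((normc b + normc c) * (e / 2))).
      by rewrite mulrDl lerD// ler_wpM2l ?normc_ge0.
    by rewrite ler_piMl// ltW.
  have [Q Q0 uB] := uQ m; exists (e / 2 / Q) => [|g gr /=]; first by rewrite divr_gt0.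
  by apply: le_trans (uB g _ (ltW gr)) _; rewrite mulrC divfK// gt_eqF.
move=> g /= ug; apply: eA; rewrite /ball /= linearD opprD addrA subrr add0r normrN.
rewrite Defs.normcE -[ltRHS]/(e%:C) ltcR; apply: le_lt_trans ug _.
by rewrite ltr_pdivrMr// ltr_pMr// ltr1n.
Qed.

Lemma ultradist_of_bounded (u : E -> R[i]) : scalar u -> step_bounded u ->
  exists v : ultradist N M h, forall f, v f = u f.
Proof.
move=> ul ub.
pose U : {scalar E} := HB.pack u (GRing.isLinear.Build R[i] E R[i] *%R u ul).
by exists (Ultradist (@step_bounded_continuous U ub)).
Qed.

(** Each test function lies in some step, on which the values of s j form a
    Cauchy sequence; the bounds on the steps are uniform in j and hence pass
    to the pointwise limit. *)
Lemma ultradist_limit (s : nat -> ultradist N M h) :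
  (forall m, exists2 Q : R, 0 < Q & forall (f : E) (r : R),
     (ultra_norm M (h m) f <= r%:E)%E -> normc (s 0%N f) <= Q * r /\
     forall j k, (j <= k)%N -> normc (s k f - s j f) <= Q * r / j.+1%:R) ->
  exists u, ultradist_cvg s u.
Proof.
move=> sQ.
have cv (f : E) : cvgn (fun j => complex.Re (s j f)) /\
    cvgn (fun j => complex.Im (s j f)).
  have [m [r _ fr]] := ultra_norm_step f; have [Q _ /(_ f r fr) [_ sB]] := sQ m.
  split; apply: (@cvg_of_rate _ _ (Q * r)) => j k jk; apply: le_trans (sB j k jk).
  - by rewrite -raddfB; exact: ler_Re_normc.
  - by rewrite -raddfB; exact: ler_Im_normc.
pose u (f : E) : R[i] :=
  limn (fun j => complex.Re (s j f)) +i* limn (fun j => complex.Im (s j f)).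
have su f : (fun j => s j f : R[i]^o) @ \oo --> (u f : R[i]^o).
  by have [? ?] := cv f; exact: cvg_complex.
have ul : scalar u.
  move=> c f g; apply: (complex_cvg_unique (su (c *: f + g))).
  rewrite (_ : (fun j => _) = fun j =>
    (c : R[i]^o) *: (s j f : R[i]^o) + s j g); last first.
    by apply/funext => j; rewrite linearP.
  by apply: cvgD (su g); apply: cvgZr; exact: su.
have ub : step_bounded u.
  move=> m; have [Q Q0 sB] := sQ m; exists (4 * Q) => [|f r fr]; first exact: mulr_gt0.
  have [s0 sj] := sB f r fr.
  have sjB j : normc (s j f) <= 2 * (Q * r).
    rewrite -(subrK (s 0%N f) (s j f)); apply: le_trans (ler_normcD _ _) _.
    by rewrite mulr_natl mulr2n; apply: lerD => //; have := sj 0%N j isT; rewrite divr1.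
  have [cr ci] := cv f.
  have lim_bound (x : nat -> R) (B : R) : cvgn x ->
      (forall j, `|x j| <= B) -> `|limn x| <= B.
    move=> cx xB; rewrite ler_norml; apply/andP; split.
    - by apply: limr_ge => //; near=> j; have := xB j; rewrite ler_norml => /andP[].
    - by apply: limr_le => //; near=> j; have := xB j; rewrite ler_norml => /andP[].
  rewrite (_ : 4 * Q * r = 2 * (Q * r) + 2 * (Q * r)); last by ring.
  apply: le_trans (ler_normc_ReIm _) _; apply: lerD; apply: lim_bound => // j.
  - exact: le_trans (ler_Re_normc _) (sjB j).
  - exact: le_trans (ler_Im_normc _) (sjB j).
have [v vE] := ultradist_of_bounded ul ub.
by exists v => f; rewrite vE.
Unshelve. all: by end_near. Qed.

End functionals.

(** * Partial sums of the series *)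

Section series.
Context {R : realType} {N : nat} {M : weightSeq R} {h : radii R}.
Local Notation E := (ultradiff N M h).
Variable a : 'rV[int]_N -> R[i].

Definition partial_form j (f : E) : R[i] :=
  ball_sum (R := R) (fun xi => a xi * pairing xi f) j.

Lemma partial_form_torus_integral j (f : E) :
  partial_form j f = torus_integral (fun x => trig_psum a j x * f x).
Proof.
have fc := csmooth_continuous (ultra_smooth f).
rewrite /partial_form /ball_sum -torus_integral_sum; last first.
  by move=> xi; exact: ccontinuousM (cexp_ccontinuous xi) fc.
congr torus_integral; apply/funext => x.
rewrite /trig_psum fsbig_finite/=; last exact: finite_lattice_ball.
by rewrite mulr_suml; apply: eq_bigr => xi _; rewrite mulrA.
Qed.

Lemma partial_form_scalar j : scalar (partial_form j).
Proof.
move=> c f g; rewrite /partial_form /ball_sum mulr_sumr -big_split.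
apply: eq_bigr => xi _; rewrite ultra_funL pairingL; last 2 first.
- exact/csmooth_continuous/ultra_smooth.
- exact/csmooth_continuous/ultra_smooth.
by rewrite /=; ring.
Qed.

(** By orthogonality, only the term of frequency xi remains. *)
Lemma partial_form_cexp j xi : enorm R xi <= j%:R ->
  partial_form j (cexpU M h (- xi)) = a xi * ((2 * pi) ^+ N)%:C.
Proof.
move=> xij; rewrite /partial_form /ball_sum.
rewrite (bigD1_seq xi) ?fset_uniq ?mem_lattice_ball//=.
rewrite pairing_cexp_diag big1 ?addr0// => eta etaxi.
by rewrite pairing_cexp ?mulr0.
Qed.

End series.

Theorem theorem4p11 (R : realType) (N : nat) (M : weightSeq R)
    (h : radii R) (a : 'rV[int]_N -> R[i]) (N_ge1 : (1 <= N)%N)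
    (a_bound : forall eps : R, 0 < eps -> exists2 C : R, 0 < C &
      forall xi : 'rV[int]_N,
        ((normc (a xi))%:E <= C%:E * ereal_sup
          [set (eps ^+ n * (1 + enorm R xi) ^+ n / (M n * n`!%:R))%:E
             | n in [set: nat]])%E) :
  exists u : ultradist N M h,
    is_trig_series a u /\ forall xi : 'rV[int]_N, fourier_coef u xi = a xi.
Proof.
have bounds m : exists2 Q : R, 0 < Q & forall (f : ultradiff N M h) (r : R),
    (ultra_norm M (h m) f <= r%:E)%E ->
    normc (partial_form a 0 f) <= Q * r /\ forall j k, (j <= k)%N ->
      normc (partial_form a k f - partial_form a j f) <= Q * r / j.+1%:R.
  have [Q Q0 QB] := term_bound a_bound N_ge1 (radius_gt0 h m).
  exists (2 * 3 ^+ N * Q) => [|f r]; first by rewrite !mulr_gt0 ?exprn_gt0.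
  move=> /(ultra_normP _ _ (radius_gt0 h m)) fr.
  have [fp fs _] := ultra_is f.
  have FQ xi := QB f r xi fs fp fr.
  split=> [|j k jk]; last first.
    by rewrite -(mulrA (2 * 3 ^+ N)); exact: ball_sum_cauchy FQ _ _ jk.
  apply: le_trans (ball_sum0_bound FQ) _; rewrite -mulrA.
  rewrite ler_peMl ?mulr_ge0 ?(ltW Q0) ?(deriv_bound_ge0 fr)//.
  by rewrite mulr_ege1 ?ler1n// exprn_ege1// ler1n.
have bounded j : step_bounded (partial_form (h := h) a j : ultradiff N M h -> _).
  move=> m; have [Q Q0 QB] := bounds m.
  exists (2 * Q) => [|f r /QB[f0 fj]]; first exact: mulr_gt0.
  rewrite -(subrK (partial_form a 0 f) (partial_form a j f)).
  apply: le_trans (ler_normcD _ _) _; rewrite -mulrA mulr_natl mulr2n.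
  by apply: lerD => //; have := fj 0%N j isT; rewrite divr1.
have [s sE] := choice (fun j =>
  ultradist_of_bounded (partial_form_scalar a j) (bounded j)).
have [|u su] := @ultradist_limit R N M h s.
  move=> m; have [Q Q0 QB] := bounds m; exists Q => // f r /QB[f0 fj].
  by rewrite sE; split=> // j k jk; rewrite !sE; exact: fj.
exists u; split.
  by exists s => // j f; rewrite sE partial_form_torus_integral.
move=> xi; rewrite /fourier_coef.
have -> : u (cexpU M h (- xi)) = a xi * ((2 * pi) ^+ N)%:C.
  apply: (complex_cvg_unique (su (cexpU M h (- xi)))).
  apply: cvg_near_cst; near=> j; rewrite sE partial_form_cexp//.
  by near: j; exact: nbhs_infty_ger.
rewrite mulrC -mulrA -rmorphM mulfV ?mulr1// gt_eqF// exprn_gt0// mulr_gt0//.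
exact: pi_gt0.
Unshelve. all: by end_near. Qed.
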